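(* Let $K$ be a global function field of characteristic $p\neq 2$. Let $\gamma,c\in K$ be distinct elements which are not both in $\overline{\mathbb{F}}_p$, and let $\phi=(x-\gamma)^2+c\in K[x]$. Suppose that $\phi^n$ is separable for every $n\geq 1$. For every $m\geq 1$ let $C_m$ be the curve $y^2=\phi^m(x)$. Then: (1) If $\gamma\neq c+t\sqrt{-c}$ for every $t\in\overline{\mathbb{F}}_p$, then $C_2$ is smooth and not isotrivial. (2) If $\gamma=c+t\sqrt{-c}$ for some $t\in\overline{\mathbb{F}}_p^*$, then $C_3$ is smooth and not isotrivial. (3) The curve $C_m$ is smooth and not isotrivial for every $m\geq 3$.
   Context: $\phi^n$ denotes the $n$-fold iterate of $\phi$ (not the $n$-th power). $\overline{\mathbb{F}}_p$ is the algebraic closure of $\mathbb{F}_p$ inside an algebraic closure $\overline{K}$ of $K$, and $\sqrt{-c}$ denotes a square root of $-c$ in $\overline{K}$. A curve $C$ over a global field $K$ of characteristic $p>0$ is called isotrivial if there is a curve $C'$ defined over $\overline{\mathbb{F}}_p$ such that $C$ is isomorphic to $C'$ over $\overline{K}$. *)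

(* Defs.v *)
From HB Require Import structures.
From mathcomp Require Import all_boot all_order all_fingroup all_algebra all_field.
From mathcomp Require Export fraction.
From mathcomp.multinomials Require Export mpoly.

Set Implicit Arguments.
Unset Strict Implicit.
Unset Printing Implicit Defensive.

Import GRing.Theory.
Local Open Scope ring_scope.

(* Projective algebraic sets over an algebraically closed field L.  A point of
   P^n(L) is represented by a nonzero row vector, up to [proj_eq]; a closed set
   is given by a finite list of homogeneous equations. *)
Section Projective.

Variable L : closedFieldType.

Definition proj_eq n (x y : 'rV[L]_n.+1) : Prop :=
  exists2 a : L, a != 0 & y = a *: x.

Definition homogeneous (R : nzRingType) n (E : seq {mpoly R[n.+1]}) : Prop :=
  forall q, q \in E -> exists d, q \is d.-homog.

Definition zeros n (E : seq {mpoly L[n.+1]}) : {pred 'rV[L]_n.+1} :=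
  fun x => (x != 0) && all (fun q : {mpoly L[n.+1]} => q.@[x 0] == 0) E.

Definition proj_sub n (E F : seq {mpoly L[n.+1]}) : Prop :=
  {subset zeros E <= zeros F}.

Definition proj_psub n (E F : seq {mpoly L[n.+1]}) : Prop :=
  proj_sub E F /\ ~ proj_sub F E.

Definition proj_irreducible n (E : seq {mpoly L[n.+1]}) : Prop :=
  [/\ homogeneous E,
      exists x, x \in zeros E &
      forall F G : seq {mpoly L[n.+1]}, homogeneous F -> homogeneous G ->
        (forall x, x \in zeros E -> (x \in zeros F) || (x \in zeros G)) ->
        proj_sub E F \/ proj_sub E G].

(* An irreducible closed set of Krull dimension one: there is a chain of
   irreducible closed subsets Z < E, and no chain Z0 < Z1 < E. *)
Definition proj_curve n (E : seq {mpoly L[n.+1]}) : Prop :=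
  [/\ proj_irreducible E,
      exists2 Z : seq {mpoly L[n.+1]}, proj_irreducible Z & proj_psub Z E &
      ~ exists Z0 Z1 : seq {mpoly L[n.+1]},
          [/\ proj_irreducible Z0, proj_irreducible Z1,
              proj_psub Z0 Z1 & proj_psub Z1 E]].

(* A morphism is given near every point by homogeneous polynomials of one common
   degree without common zero at the point.  The neighbourhood may be taken to
   be the whole nonvanishing locus of P : if the formula is valid on a smaller
   neighbourhood, multiply P by a form vanishing off that neighbourhood but not
   at x.  Since x' may be any multiple of x, the condition also makes f
   compatible with [proj_eq] on zeros E. *)
Definition proj_morphism n m (E : seq {mpoly L[n.+1]})
    (F : seq {mpoly L[m.+1]}) (f : 'rV[L]_n.+1 -> 'rV[L]_m.+1) : Prop :=
  (forall x, x \in zeros E -> f x \in zeros F) /\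
  (forall x, x \in zeros E ->
     exists d : nat, exists P : 'I_m.+1 -> {mpoly L[n.+1]},
       [/\ forall j, P j \is d.-homog,
           \row_j (P j).@[x 0] != 0 &
           forall x', x' \in zeros E -> \row_j (P j).@[x' 0] != 0 ->
             proj_eq (f x') (\row_j (P j).@[x' 0])]).

Definition proj_isomorphic n m (E : seq {mpoly L[n.+1]})
    (F : seq {mpoly L[m.+1]}) : Prop :=
  exists f g,
    [/\ proj_morphism E F f, proj_morphism F E g,
        forall x, x \in zeros E -> proj_eq (g (f x)) x &
        forall y, y \in zeros F -> proj_eq (f (g y)) y].

(* Jacobian criterion in P^n for the curve with equations E : the Jacobian
   matrix has rank n - 1 at every point. *)
Definition jacobian n (E : seq {mpoly L[n.+1]}) (x : 'rV[L]_n.+1) :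
    'M[L]_(size E, n.+1) :=
  \matrix_(i, j) ((E`_i)^`M(j)).@[x 0].

Definition proj_smooth n (E : seq {mpoly L[n.+1]}) : Prop :=
  forall x, x \in zeros E -> (\rank (jacobian E x)).+1 = n.

End Projective.

(* The algebraic closure of F_p in a field L of characteristic p. *)
Definition in_Fpbar (p : nat) (L : fieldType) (z : L) : Prop :=
  algebraicOver (fun a : 'F_p => (nat_of_ord a)%:R : L) z.

(* Curves over K, by equations with coefficients in K ; iota is an embedding of
   K in an algebraic closure L. *)
Section CurvesOverK.

Variables (K : fieldType) (L : closedFieldType) (iota : {rmorphism K -> L}).

Definition base_change n (E : seq {mpoly K[n.+1]}) : seq {mpoly L[n.+1]} :=
  [seq map_mpoly iota q | q <- E].

Definition smooth_curve n (E : seq {mpoly K[n.+1]}) : Prop :=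
  proj_smooth (base_change E).

Definition isotrivial (p : nat) n (E : seq {mpoly K[n.+1]}) : Prop :=
  exists n' : nat, exists E' : seq {mpoly L[n'.+1]},
    [/\ proj_curve E',
        forall q, q \in E' -> forall k, in_Fpbar p q@_k &
        proj_isomorphic (base_change E) E'].

End CurvesOverK.

(* The complete model of y^2 = f(x), for f of degree 2e or 2e - 1 (e >= 1), in
   P^(e+1) : the variables are X_0, ..., X_e and Y = X_(e+1), and the equations
     X_i X_(j+1) = X_(i+1) X_j   (i, j < e),
     Y^2 = \sum_k f_k X_(floor (k/2)) X_(ceil (k/2)).
   On the chart X_0 = 1 one has X_i = x^i with x = X_1, so this chart is the
   affine plane curve y^2 = f(x) ; on the chart X_e = 1, X_i = u^(e-i) with
   u = X_(e-1), and one gets y^2 = u^(2e) f(1/u).  The two charts cover the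
   curve.  The plane closure of y^2 = f(x) is not used, since it is singular
   at infinity as soon as deg f >= 4. *)
Definition hyperelliptic (K : fieldType) (f : {poly K}) :
    seq {mpoly K[((size f)./2).+2]} :=
  let e := (size f)./2 in
  let X (i : nat) : {mpoly K[e.+2]} := 'X_(inord i) in
  (X e.+1 ^+ 2 - \sum_(k < size f) f`_k *: (X k./2 * X (uphalf k)))
  :: [seq X i * X j.+1 - X i.+1 * X j | i <- iota 0 e, j <- iota 0 e].

Definition quad (K : fieldType) (gamma c : K) : {poly K} :=
  ('X - gamma%:P) ^+ 2 + c%:P.

(* n-fold composition of phi with itself. *)
Definition iter_poly (K : fieldType) (phi : {poly K}) (n : nat) : {poly K} :=
  iter n (fun q => q \Po phi) 'X.

(* Main.v *)
(** Let [f] be the [m]-th iterate, of degree [2e], and suppose that the model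
    of [y^2 = f(x)] is isomorphic to a curve [E'] over the algebraic closure
    of [F_p].  A power [q] of [p] fixes the coefficients of [E'], and
    conjugating the isomorphism by Frobenius gives an isomorphism [h] from
    [y^2 = f(x)] to [y^2 = f1(x)], where [f1] has the [q]-th powers of the
    coefficients of [f].

    Let [X(x, y)] be the first coordinate of [h], a rational function.  The
    minimal polynomial [F(x, T)] of [X] over [L(x)], made primitive in
    [L[x][T]], has degree at most [2] in [T]; by Gauss's lemma it divides the
    relation expressing that [x] is quadratic over [L(X)], so it also has
    degree at most [2] in [x].  If [X] is not in [L(x)], the discriminant of
    [F] in [T], of degree at most [4], is a square times [f]; hence [e = 2],
    and the two discriminants of the biquadratic form [F] are proportional to
    [f] and [f1].  These discriminants have the same invariants, so the
    [j]-invariant of [f] is fixed by the [q]-th power map.  If [X] is in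
    [L(x)], it is a Moebius map sending the roots of [f] to those of [f1], so
    the [q]-th power map permutes the finite set of cross-ratios of roots of
    [f], which therefore all lie in the closure of [F_p].

    The roots of [f] come in pairs [gamma + b, gamma - b] with [b^2 = r - c],
    [r] a root of the previous iterate, and the cross-ratio of two pairs is
    [((b - b') / (b + b'))^2].  So all ratios [b' / b] are constant, which
    one step lower makes [a / (gamma - c)] constant whenever [a^2 = r - c].
    For [m = 2] this concerns [a^2 = - c]; for [m >= 3] the sum of
    [(gamma - c + a) / (gamma - c)^2] and its conjugate shows that
    [gamma - c], and then [c], is constant. *)

Require Import Defs.
From mathcomp Require Import all_boot all_order all_algebra all_field.
From mathcomp Require Import ring zify.

Set Implicit Arguments.
Unset Strict Implicit.
Unset Printing Implicit Defensive.

Import GRing.Theory.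
Local Open Scope ring_scope.

(** * Polynomials over an algebraically closed field *)

(* The library's [hornerE] also normalizes products, into a form that [ring] and
   [field] do not parse. *)
Definition horner_ringE :=
  (hornerD, hornerN, hornerM, horner_exp, hornerMn, hornerZ, hornerC, hornerX,
   horner0).

Section ClosedFieldPoly.
Variable L : closedFieldType.
Implicit Types (f g p q a b c A B E W Z : {poly L}) (F G Q : {poly {poly L}}).

(** [p - 1] takes only the value [-1], so it has no root and is therefore constant. *)
Lemma poly_horner_eq0 p : (forall x, p.[x] = 0) -> p = 0.
Proof.
move=> p0; apply/eqP; case: (eqVneq (size (p - 1)) 1%N) => [/eqP/size_poly1P[k _ pk]|].
  have {}pk : p = (k + 1)%:P by rewrite polyCD -pk subrK.
  by move: (p0 0); rewrite pk hornerC => ->; rewrite polyC0.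
move/(closed_rootP (p - 1)) => [x]; rewrite rootE hornerD hornerN p0 hornerC sub0r oppr_eq0 oner_eq0 //.
Qed.

Lemma poly_horner_ae_eq0 Z p :
  Z != 0 -> (forall x, Z.[x] != 0 -> p.[x] = 0) -> p = 0.
Proof.
move=> Z0 Zp; have /eqP : Z * p = 0.
  apply: poly_horner_eq0 => x; rewrite hornerM.
  by have [->|/Zp ->] := eqVneq Z.[x] 0; rewrite ?mul0r ?mulr0.
by rewrite mulf_eq0 (negPf Z0) => /eqP.
Qed.

(** A root [x] of [Z * 'X - 1] satisfies [Z.[x] * x = 1]. *)
Lemma poly_nonroot Z : Z != 0 -> exists x, Z.[x] != 0.
Proof.
move=> Z0; case: (eqVneq (size (Z * 'X - 1)) 1%N) => [/eqP/size_poly1P[k k0 Zk]|].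
  have : size (Z * 'X) = size (k + 1)%:P by rewrite polyCD -Zk subrK.
  rewrite size_mulX // size_polyC; case: (size Z) (size_poly_eq0 Z) => [|n].
    by rewrite (negPf Z0).
  by case: (k + 1 != 0).
move/(closed_rootP _) => [x]; rewrite rootE !horner_ringE subr_eq0 => /eqP H.
by exists x; apply: contraTneq isT => H0; move: H; rewrite H0 mul0r => /eqP; rewrite eq_sym oner_eq0.
Qed.

Lemma closed_sqrt (z : L) : exists y, y ^+ 2 = z.
Proof.
have [|y] := @solve_monicpoly L 2 (fun i => if i == 0%N then z else 0); first by [].
by rewrite !big_ord_recl big_ord0 /= mulr1 mul0r !addr0; exists y.
Qed.

(** Once the common factor of [E] and [W] is cancelled, the square of what is left of [E] divides
    the squarefree [f]; so [E] divides [W]. *)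
Lemma separable_sq_dvd f g E W : separable_poly f -> E != 0 ->
  E ^+ 2 * g = W ^+ 2 * f -> exists V, W = V * E /\ g = V ^+ 2 * f.
Proof.
move=> sepf E0 H.
have d0 : gcdp E W != 0 by rewrite gcdp_eq0 (negPf E0).
have dE : gcdp E W %| E by rewrite dvdp_gcdl.
have dW : gcdp E W %| W by rewrite dvdp_gcdr.
set d := gcdp E W in d0 dE dW.
have cop : coprimep (E %/ d) (W %/ d) by rewrite coprimep_div_gcd // E0.
move: H; rewrite -{1}(divpK dE) -{1}(divpK dW).
set e := E %/ d in cop *; set w := W %/ d in cop *.
have -> : (e * d) ^+ 2 * g = d ^+ 2 * (e ^+ 2 * g) by ring.
have -> : (w * d) ^+ 2 * f = d ^+ 2 * (w ^+ 2 * f) by ring.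
move/(mulfI (expf_neq0 2 d0)) => H.
have ef : e ^+ 2 %| f.
  rewrite -(@Gauss_dvdpr _ _ (w ^+ 2)); first by rewrite -H dvdp_mulr.
  by rewrite coprimep_expl // coprimep_expr.
have se : size e == 1%N.
  by apply: contraT => se; rewrite -(separable_nosquare sepf (isT : 1 < 2)%N se).
case/size_poly1P: se => k k0 ek.
exists (k^-1 *: w); split.
  rewrite -{1}(divpK dW) -(divpK dE) -/e -/w ek.
  by rewrite mul_polyC -scalerAl -scalerAr scalerA mulVf // scale1r.
move: H; rewrite ek => H; rewrite exprZn -scalerAl -H -polyC_exp mul_polyC scalerA.
by rewrite -exprMn mulVf // expr1n scale1r.
Qed.

(** A nonconstant squarefree [f] is not a square in [L(x)]: for nonzero [b], [separable_sq_dvd] with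
    the separable polynomial [1] would make [f] a square. *)
Lemma separable_nonsquare f a b : separable_poly f -> (1 < size f)%N ->
  a ^+ 2 = b ^+ 2 * f -> a = 0 /\ b = 0.
Proof.
move=> sepf sf H; have [b0|b0] := eqVneq b 0.
  by split=> //; move/eqP: H; rewrite b0 expr0n mul0r expf_eq0 => /eqP.
have s1 : separable_poly (1 : {poly L}) by rewrite unlock coprime1p.
have [|V [_ fV]] := @separable_sq_dvd 1 f b a s1 b0; first by rewrite mulr1 -H.
have sV : size V == 1%N.
  apply: contraT => sV; rewrite -(separable_nosquare sepf (isT : 1 < 2)%N sV).
  by rewrite fV mulr1.
move: sf; rewrite fV mulr1; case/size_poly1P: sV => k k0 ->.
by rewrite -polyC_exp size_polyC; case: (_ != 0).
Qed.

(** The norm [a ^+ 2 - b ^+ 2 * f] of [a + b y] vanishes off the roots of [Z], hence is zero. *)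
Lemma curve_fun_eq0 f Z a b : separable_poly f -> (1 < size f)%N -> Z != 0 ->
  (forall x y, y ^+ 2 = f.[x] -> Z.[x] != 0 -> a.[x] + b.[x] * y = 0) ->
  a = 0 /\ b = 0.
Proof.
move=> sepf sf Z0 H; apply: (separable_nonsquare sepf sf).
apply/eqP; rewrite -subr_eq0; apply/eqP.
apply: (poly_horner_ae_eq0 Z0) => x Zx; have [y yf] := closed_sqrt f.[x].
have := H x y yf Zx => /eqP; rewrite addr_eq0 => /eqP ax.
by rewrite !horner_ringE ax -yf; ring.
Qed.

(* In [F : {poly {poly L}}] the outer variable is written [T], the inner one
   [x]; so [F.[t%:P].[x]] is [F(x, t)]. *)
Definition primitiveX F := forall a : L, map_poly (horner_eval a) F != 0.

Lemma dvdp_coef_root (a : L) F : map_poly (horner_eval a) F = 0 ->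
  exists G, F = ('X - a%:P) *: G.
Proof.
move=> Fa; exists (map_poly (fun p => p %/ ('X - a%:P)) F).
apply/polyP => i; rewrite coefZ coef_map_id0 ?div0p // mulrC divpK //.
rewrite dvdp_XsubCl rootE; have := congr1 (fun p : {poly L} => p`_i) Fa.
by rewrite coef_map /= coef0 /horner_eval => ->.
Qed.

Lemma seq_gcdp (s : seq {poly L}) : exists d,
  (forall p, p \in s -> d %| p) /\
  (forall e, (forall p, p \in s -> e %| p) -> e %| d).
Proof.
elim: s => [|q s [d [dP dM]]]; first by exists 0; split=> // e _; exact: dvdp0.
exists (gcdp q d); split=> [p|e He].
  rewrite inE => /predU1P[->|/dP]; first exact: dvdp_gcdl.
  by apply: dvdp_trans; exact: dvdp_gcdr.
rewrite dvdp_gcd He ?mem_head //=; apply: dM => p ps.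
by apply: He; rewrite inE ps orbT.
Qed.

Lemma primitiveX_part F : F != 0 ->
  exists c G, [/\ c != 0, F = c *: G & primitiveX G].
Proof.
move=> F0; have [d [dP dM]] := seq_gcdp F.
have dF i : d %| F`_i.
  have [iF|Fi] := ltnP i (size F); first by apply: dP; exact: mem_nth.
  by rewrite nth_default ?dvdp0.
have d0 : d != 0.
  apply: contraNneq F0 => d0; apply/eqP/polyP => i; apply/eqP.
  by move: (dF i); rewrite d0 dvd0p coef0.
have FE : F = d *: map_poly (fun p => p %/ d) F.
  apply/polyP => i; rewrite coefZ coef_map_id0 ?div0p // mulrC divpK //.
exists d, (map_poly (fun p => p %/ d) F); split=> // a.
apply/eqP => /dvdp_coef_root[G GE].
(* If the quotient vanished at [x = a], the content [d] could be enlarged by the factor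
   ['X - a%:P]. *)
have : d * ('X - a%:P) %| d.
  apply: dM => p /(nthP 0)[i _ <-].
  by rewrite FE GE scalerA coefZ dvdp_mulr.
rewrite -{2}[d]mulr1 dvdp_mul2l // => /dvdp_leq; rewrite oner_eq0 size_XsubC size_poly1.
by move/(_ isT).
Qed.

(** Gauss's lemma, removing the roots of [c] one at a time: at a root [a] the product [Q * F]
    vanishes, [F] does not, and [L[T]] is a domain, so ['X - a%:P] divides [Q]. *)
Lemma gauss_primitiveX F G Q c : c != 0 -> primitiveX F -> c *: G = Q * F ->
  exists Q', G = Q' * F.
Proof.
move=> + pF; move: {2}(size c) (leqnn (size c)) => n.
elim: n c Q => [|n IHn] c Q sc c0.
  by move: sc; rewrite leqn0 size_poly_eq0 (negPf c0).
case: (eqVneq (size c) 1%N) => [/eqP/size_poly1P[k k0 ->] H|].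
  exists (k^-1%:P *: Q); rewrite -scalerAl -H scalerA -polyCM mulVf //.
  by rewrite scale1r.
move/(closed_rootP c) => [a /factor_theorem [d dc]] H.
have aF : map_poly (horner_eval a) Q = 0.
  move/(congr1 (map_poly (horner_eval a))): H.
  rewrite rmorphM /= map_polyZ /= dc /horner_eval !horner_ringE subrr mulr0 scale0r.
  by move/esym/eqP; rewrite mulf_eq0 (negPf (pF a)) orbF => /eqP.
have [Q1 Q1E] := dvdp_coef_root aF.
have XA0 := polyXsubC_eq0 a.
apply: (IHn d Q1).
- move: sc; rewrite dc size_Mmonic ?monicXsubC //; last first.
    by apply: contraNneq c0; rewrite dc => ->; rewrite mul0r.
  by rewrite size_XsubC addnS addn1.
- by apply: contraNneq c0; rewrite dc => ->; rewrite mul0r.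
apply: (@mulfI _ ('X - a%:P)%:P); first by rewrite polyC_eq0 XA0.
by rewrite !mul_polyC scalerA mulrC -dc H Q1E scalerAl.
Qed.

Definition rat_xy A B E (x y : L) : L := (A.[x] + B.[x] * y) / E.[x].

Lemma horner2_small F (x t : L) : (size F <= 3)%N ->
  F.[t%:P].[x] = (F`_0).[x] + (F`_1).[x] * t + (F`_2).[x] * t ^+ 2.
Proof.
move=> sF; rewrite (horner_coef_wide _ sF) !big_ord_recr big_ord0 /= add0r.
by rewrite !horner_ringE expr0 mulr1 expr1.
Qed.

(** [F] is the primitive minimal polynomial of [(A + B y) / E] over [L(x)]. Divisibility holds first
    in [L(x)[T]], where a remainder of smaller degree must vanish, and then in [L[x][T]] by Gauss's
    lemma. *)
Lemma minimal_relation f A B E : separable_poly f -> (1 < size f)%N -> E != 0 ->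
  exists F, [/\ primitiveX F, F != 0, size F = (B != 0).+2,
    (forall x y, y ^+ 2 = f.[x] -> E.[x] != 0 ->
       F.[(rat_xy A B E x y)%:P].[x] = 0) &
    forall G Z, Z != 0 ->
      (forall x y, y ^+ 2 = f.[x] -> Z.[x] != 0 -> E.[x] != 0 ->
         G.[(rat_xy A B E x y)%:P].[x] = 0) -> exists Q, G = Q * F].
Proof.
move=> sepf sf E0.
(* Expanded from [(E T - A)^2 = B^2 f], or from [E T = A] when [B = 0]. *)
pose F0 : {poly {poly L}} := if B != 0 then
    Poly [:: A ^+ 2 - B ^+ 2 * f; - (A * E *+ 2); E ^+ 2] else Poly [:: - A; E].
have F0c : polyseq F0 = if B != 0 then
    [:: A ^+ 2 - B ^+ 2 * f; - (A * E *+ 2); E ^+ 2] else [:: - A; E] :> seq _.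
  by rewrite /F0; case: (B != 0); apply: (@PolyK _ 0); rewrite /= ?expf_neq0.
have sF0 : size F0 = (B != 0).+2 by rewrite F0c; case: (B != 0).
have F00 : F0 != 0 by rewrite -size_poly_eq0 sF0.
have Fv0 x y : y ^+ 2 = f.[x] -> E.[x] != 0 ->
    F0.[(rat_xy A B E x y)%:P].[x] = 0.
  move=> yf Ex; rewrite horner2_small; last by rewrite sF0; case: (B != 0).
  rewrite F0c /rat_xy; have [-> /=|B0 /=] := eqVneq B 0; rewrite !horner_ringE.
    by field.
  by rewrite -yf; field.
have [c [F [c0 F0E pF]]] := primitiveX_part F00.
have sF : size F = (B != 0).+2 by rewrite -sF0 F0E -mul_polyC size_Cmul.
have F'0 : F != 0 by rewrite -size_poly_eq0 sF.
have lF : lead_coef F * c = if B != 0 then E ^+ 2 else E.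
  rewrite lead_coefE sF mulrC -coefZ -F0E F0c; by case: (B != 0).
have Fv x y : y ^+ 2 = f.[x] -> E.[x] != 0 ->
    F.[(rat_xy A B E x y)%:P].[x] = 0.
  move=> yf Ex; have := Fv0 x y yf Ex; rewrite F0E -mul_polyC !horner_ringE.
  move/eqP; rewrite mulf_eq0 => /orP[/eqP cx|/eqP //].
  have := congr1 (horner^~ x) lF; rewrite hornerM cx mulr0.
  case: (B != 0) => /esym/eqP; last by rewrite (negPf Ex).
  by rewrite horner_exp expf_eq0 /= (negPf Ex).
exists F; split=> // G Z Z0 HG.
(* This is a pseudo-division: [G] is multiplied by a power of the leading coefficient of [F], which
   [gauss_primitiveX] removes at the end. *)
pose R := G %% F; have GE := Pdiv.Idomain.divp_eq G F.
have sR : (size R < (B != 0%R).+2)%N by rewrite -sF ltn_modp.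
have R2 : (size R <= 2)%N by move: sR; case: (B != 0) => // /ltnW.
have Rv x y : y ^+ 2 = f.[x] -> (Z * E).[x] != 0 ->
    (R`_0 * E + R`_1 * A).[x] + (R`_1 * B).[x] * y = 0.
  rewrite hornerM mulf_eq0 negb_or => yf /andP[Zx Ex].
  have := congr1 (fun H : {poly {poly L}} => H.[(rat_xy A B E x y)%:P].[x]) GE.
  rewrite -mul_polyC !horner_ringE HG // mulr0 Fv // mulr0 add0r.
  rewrite horner2_small; last exact: leqW.
  rewrite (nth_default _ R2) /rat_xy => /esym H.
  transitivity (0 * E.[x]); last by rewrite mul0r.
  by rewrite -H !horner_ringE; field.
have [R0 R1] := curve_fun_eq0 sepf sf (mulf_neq0 Z0 E0) Rv.
have R10 : R`_1 = 0.
  have [B0|B0] := eqVneq B 0.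
    by rewrite nth_default //; move: sR; rewrite B0 eqxx.
  by move/eqP: R1; rewrite mulf_eq0 (negPf B0) orbF => /eqP.
have R00 : R`_0 = 0.
  by move/eqP: R0; rewrite R10 mul0r addr0 mulf_eq0 (negPf E0) orbF => /eqP.
have R_0 : R = 0.
  apply/polyP => -[|[|i]]; rewrite coef0 ?R00 ?R10 // nth_default //.
  exact: leq_trans R2 _.
move: GE; rewrite -/R R_0 addr0; apply: gauss_primitiveX => //.
by rewrite expf_neq0 // lead_coef_eq0.
Qed.

(** Substituting [T = (A + B y) / E] and separating the part in [y] gives [F_1 E = - 2 F_2 A], then
    [E^2 disc(F) = (2 F_2 B)^2 f]; [separable_sq_dvd] divides out [E^2]. *)
Lemma relation_discriminant f A B E F Z : separable_poly f -> (1 < size f)%N ->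
  E != 0 -> B != 0 -> Z != 0 -> F != 0 -> (size F <= 3)%N ->
  (2%:R : L) != 0 ->
  (forall x y, y ^+ 2 = f.[x] -> Z.[x] != 0 -> E.[x] != 0 ->
     F.[(rat_xy A B E x y)%:P].[x] = 0) ->
  exists2 V, V != 0 & F`_1 ^+ 2 - F`_0 * F`_2 *+ 4 = V ^+ 2 * f.
Proof.
move=> sepf sf E0 B0 Z0 F0 sF two Fv.
have H x y : y ^+ 2 = f.[x] -> (Z * E).[x] != 0 ->
    (F`_0 * E ^+ 2 + F`_1 * E * A + F`_2 * (A ^+ 2 + B ^+ 2 * f)).[x]
    + ((F`_1 * E + F`_2 * A *+ 2) * B).[x] * y = 0.
  rewrite hornerM mulf_eq0 negb_or => yf /andP[Zx Ex].
  have := Fv x y yf Zx Ex; rewrite horner2_small // /rat_xy => H.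
  transitivity (0 * E.[x] ^+ 2); last by rewrite mul0r.
  by rewrite -H !horner_ringE -yf; field.
have [H0 /eqP] := curve_fun_eq0 sepf sf (mulf_neq0 Z0 E0) H.
rewrite mulf_eq0 (negPf B0) orbF addr_eq0 => /eqP H1.
have F20 : F`_2 != 0.
  apply: contraNneq F0 => F20; apply/eqP/polyP => i; rewrite coef0.
  have F10 : F`_1 = 0.
    by move/eqP: H1; rewrite F20 mul0r mul0rn oppr0 mulf_eq0 (negPf E0) orbF => /eqP.
  case: i => [|[|[|i]]] //; last by rewrite nth_default // (leq_trans sF).
  move/eqP: H0; rewrite F20 F10 !mul0r !addr0 mulf_eq0 expf_eq0 (negPf E0) andbF.
  by rewrite orbF => /eqP.
have [|V [VE ->]] := @separable_sq_dvd f (F`_1 ^+ 2 - F`_0 * F`_2 *+ 4) E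
   (F`_2 * B *+ 2) sepf E0.
  have -> : E ^+ 2 * (F`_1 ^+ 2 - F`_0 * F`_2 *+ 4) =
    (F`_1 * E) ^+ 2 - (F`_0 * E ^+ 2) * F`_2 *+ 4 by ring.
  have -> : F`_0 * E ^+ 2 = F`_0 * E ^+ 2 + F`_1 * E * A
      + F`_2 * (A ^+ 2 + B ^+ 2 * f) - F`_1 * E * A - F`_2 * (A ^+ 2 + B ^+ 2 * f).
    by ring.
  rewrite H0.
  by rewrite H1; ring.
exists V => //; apply: contraTneq isT => V0.
move/eqP: VE; rewrite V0 mul0r -mulr_natr !mulf_eq0 (negPf F20) (negPf B0) /=.
by rewrite -polyC_natr polyC_eq0 (negPf two).
Qed.
End ClosedFieldPoly.

(** * Biquadratic correspondences *)

(** The invariant [I], of degree two, of the binary quartic with these coefficients; with [D] the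
    discriminant, [256 I^3 / D] is the j-invariant of the double cover branched at its roots. *)
Definition quarticI (R : nzRingType) (a b c d e : R) : R :=
  a * e *+ 12 - b * d *+ 3 + c ^+ 2.

(* The discriminant: [27 D = 4 I^3 - J^2] for the cubic invariant [J], which is
   useless in characteristic 3. *)
Definition quarticD (R : nzRingType) (a b c d e : R) : R :=
  a ^+ 3 * e ^+ 3 *+ 256 - a ^+ 2 * b * d * e ^+ 2 *+ 192
  - a ^+ 2 * c ^+ 2 * e ^+ 2 *+ 128 + a ^+ 2 * c * d ^+ 2 * e *+ 144
  - a ^+ 2 * d ^+ 4 *+ 27 + a * b ^+ 2 * c * e ^+ 2 *+ 144
  - a * b ^+ 2 * d ^+ 2 * e *+ 6 - a * b * c ^+ 2 * d * e *+ 80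
  + a * b * c * d ^+ 3 *+ 18 + a * c ^+ 4 * e *+ 16 - a * c ^+ 3 * d ^+ 2 *+ 4
  - b ^+ 4 * e ^+ 2 *+ 27 + b ^+ 3 * c * d * e *+ 18 - b ^+ 3 * d ^+ 3 *+ 4
  - b ^+ 2 * c ^+ 3 * e *+ 4 + b ^+ 2 * c ^+ 2 * d ^+ 2.

Definition polyI (R : nzRingType) (f : {poly R}) := quarticI f`_4 f`_3 f`_2 f`_1 f`_0.
Definition polyD (R : nzRingType) (f : {poly R}) := quarticD f`_4 f`_3 f`_2 f`_1 f`_0.

(** Here [k] is the size of [V], and [V ^+ 2 * f] has degree at most [4]. *)
Lemma degree_count k e : (0 < k -> 2 <= e -> k.-1.*2 + e.*2.+1 <= 5 ->
  e = 2 /\ k = 1)%N.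
Proof. by case: k => // k _ /=; lia. Qed.

Section Correspondence.
Variable L : closedFieldType.
Hypothesis two_neq0 : (2%:R : L) != 0.
Implicit Types (f p q : {poly L}) (F : {poly {poly L}}).

Definition discX F : {poly L} := F`_1 ^+ 2 - F`_0 * F`_2 *+ 4.

Lemma coef_discX F k : (sizeY F <= 3)%N -> (k <= 4)%N ->
  (discX F)`_k = [:: F`_1`_0 ^+ 2 - F`_0`_0 * F`_2`_0 *+ 4;
    F`_1`_0 * F`_1`_1 *+ 2 - (F`_0`_0 * F`_2`_1 + F`_0`_1 * F`_2`_0) *+ 4;
    F`_1`_1 ^+ 2 + F`_1`_0 * F`_1`_2 *+ 2
      - (F`_0`_0 * F`_2`_2 + F`_0`_1 * F`_2`_1 + F`_0`_2 * F`_2`_0) *+ 4;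
    F`_1`_1 * F`_1`_2 *+ 2 - (F`_0`_1 * F`_2`_2 + F`_0`_2 * F`_2`_1) *+ 4;
    F`_1`_2 ^+ 2 - F`_0`_2 * F`_2`_2 *+ 4]`_k.
Proof.
move=> sF; have F3 i j : (3 <= j)%N -> F`_i`_j = 0.
  move=> j3; rewrite nth_default //; apply: leq_trans j3.
  exact: leq_trans (max_size_coefXY _ _) sF.
rewrite /discX expr2; case: k => [|[|[|[|[|k]]]]] // _ /=;
rewrite coefB coefMn !coefM !big_ord_recr !big_ord0 /= ?(F3 _ 3%N) ?(F3 _ 4%N) //;
rewrite ?subSS ?subn0 ?subnn /= ?(F3 _ 3%N) ?(F3 _ 4%N) //; ring.
Qed.

Lemma size_discX F n : (sizeY F <= n.+1)%N -> (size (discX F) <= n.*2.+1)%N.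
Proof.
move=> sF; have sc i : (size (F`_i)%R <= n.+1)%N by apply: leq_trans (max_size_coefXY _ _) sF.
have add_le a b : (a <= n.+1 -> b <= n.+1 -> (a + b).-1 <= n.*2.+1)%N by lia.
rewrite /discX expr2; apply: (leq_trans (size_polyD _ _)).
rewrite geq_max size_polyN -scaler_nat; apply/andP; split.
  by apply: (leq_trans (size_polyMleq _ _)); apply: add_le.
apply: (leq_trans (size_scale_leq _ _)).
by apply: (leq_trans (size_polyMleq _ _)); apply: add_le.
Qed.

(** The two discriminants are the branch quartics of the two projections of the curve [F = 0],
    generically of genus one, so they share their invariants; both equalities are polynomial
    identities in the nine coefficients. *)
Lemma polyI_discX_swap F : (size F <= 3)%N -> (sizeY F <= 3)%N ->
  polyI (discX (swapXY F)) = polyI (discX F) /\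
  polyD (discX (swapXY F)) = polyD (discX F).
Proof.
move=> sF sYF; have sYF' : (sizeY (swapXY F) <= 3)%N by rewrite sizeYE swapXYK.
rewrite /polyI /polyD !(coef_discX sYF) // !(coef_discX sYF') //= !coef_swapXY.
by rewrite /quarticI /quarticD; split; ring.
Qed.

Lemma polyI_scale k f : polyI (k *: f) = k ^+ 2 * polyI f.
Proof. by rewrite /polyI /quarticI !coefZ; ring. Qed.

Lemma polyD_scale k f : polyD (k *: f) = k ^+ 6 * polyD f.
Proof. by rewrite /polyD /quarticD !coefZ; ring. Qed.

(* [(X, Y) = ((A + B y) / E, (C + D y) / E)] *)
Record rat_map := RatMap {
  mA : {poly L}; mB : {poly L}; mC : {poly L}; mD : {poly L}; mE : {poly L} }.
Definition mX m (x y : L) := rat_xy (mA m) (mB m) (mE m) x y.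
Definition mY m (x y : L) := rat_xy (mC m) (mD m) (mE m) x y.

Definition rat_inverse (f f1 : {poly L}) (m m1 : rat_map) Z :=
  Z != 0 /\ forall x y, y ^+ 2 = f.[x] -> Z.[x] != 0 ->
   [/\ (mE m).[x] != 0, mY m x y ^+ 2 = f1.[mX m x y], (mE m1).[mX m x y] != 0,
       mX m1 (mX m x y) (mY m x y) = x & mY m1 (mX m x y) (mY m x y) = y].

Lemma sizeY_factor F G Q : G = Q * F -> G != 0 -> (sizeY F <= sizeY G)%N.
Proof.
move=> GE; rewrite {1}GE mulf_eq0 negb_or => /andP[Q0 F0].
have Q0' : swapXY Q != 0 by rewrite swapXY_eq0.
have F0' : swapXY F != 0 by rewrite swapXY_eq0.
rewrite !sizeYE GE rmorphM size_mul //.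
move: (size_poly_eq0 (swapXY Q)); rewrite (negPf Q0').
by case: (size (swapXY Q)) => //= n _; rewrite leq_addl.
Qed.

Lemma swapXY_sqB F p : swapXY (F ^+ 2 - map_poly polyC p) = swapXY F ^+ 2 - p%:P.
Proof. by rewrite -swapXY_map_polyC -rmorphXn -rmorphB. Qed.

Lemma swapXY_linear p q : swapXY (map_poly polyC p * 'X%:P - map_poly polyC q) = p%:P * 'X - q%:P.
Proof. by rewrite -swapXY_Y -!swapXY_map_polyC -rmorphM -rmorphB. Qed.

Lemma relation_degree f f1 m m1 Z : separable_poly f -> (1 < size f)%N ->
  mE m != 0 -> mE m1 != 0 -> rat_inverse f f1 m m1 Z ->
  exists F, [/\ primitiveX F, F != 0, size F = (mB m != 0).+2,
    (sizeY F <= (mB m1 != 0%R).+2)%N &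
    forall x y, y ^+ 2 = f.[x] -> (mE m).[x] != 0 -> F.[(mX m x y)%:P].[x] = 0].
Proof.
move=> sepf sf E0 E10 [Z0 inv].
have [F [pF F0 sF Fv Fdvd]] := minimal_relation (mA m) (mB m) sepf sf E0.
exists F; split=> //.
pose G1 : {poly {poly L}} := map_poly polyC (mE m1) * 'X%:P - map_poly polyC (mA m1).
(* This eliminates [Y] from [x E1(X) - A1(X) = B1(X) Y] by means of [Y^2 = f1(X)]; its degree in [x]
   bounds that of its divisor [F]. *)
pose G := if mB m1 != 0 then G1 ^+ 2 - map_poly polyC (mB m1 ^+ 2 * f1) else G1.
have G1E (t x : L) : G1.[t%:P].[x] = (mE m1).[t] * x - (mA m1).[t].
  by rewrite /G1 !horner_ringE !horner_map !horner_ringE.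
have [|Q QE] := Fdvd G Z Z0.
  move=> x y yf Zx Ex; have [_ Y2 E1 xE _] := inv x y yf Zx.
  have {}xE : (mA m1).[mX m x y] + (mB m1).[mX m x y] * mY m x y = x * (mE m1).[mX m x y].
    by rewrite -[LHS](divfK E1); congr (_ * _); exact: xE.
  rewrite -/(mX m x y) /G; have [B10|B10] := eqVneq (mB m1) 0 => /=.
    by rewrite G1E mulrC -xE B10 horner0 mul0r addr0 subrr.
  rewrite hornerD hornerN horner_exp hornerD hornerN horner_exp G1E horner_map hornerC.
  by rewrite !horner_ringE -Y2 mulrC -xE; ring.
have sG1 : swapXY G1 = (mE m1)%:P * 'X - (mA m1)%:P.
  exact: swapXY_linear.
have ssG1 : size (swapXY G1) = 2%N.
  rewrite sG1 size_polyDl ?size_mulX ?polyC_eq0 ?size_polyC ?E10 //.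
  by rewrite size_polyN size_polyC; case: (_ != 0).
have G10 : G1 != 0 by rewrite -swapXY_eq0 -size_poly_eq0 ssG1.
have sG : sizeY G = (mB m1 != 0).+2.
  rewrite sizeYE /G; have [B10|B10] := eqVneq (mB m1) 0 => //=.
  rewrite swapXY_sqB.
  have s3 : size (swapXY G1 ^+ 2) = 3%N.
    by rewrite expr2 size_mul ?ssG1 // -size_poly_eq0 ssG1.
  rewrite size_polyDl ?s3 // size_polyN size_polyC; by case: (_ != 0).
by rewrite -sG; apply: (sizeY_factor QE); rewrite -sizeY_eq0 sG.
Qed.

Lemma size_sq_mul p q : p != 0 -> q != 0 -> size (p ^+ 2 * q) = ((size p).-1.*2 + size q)%N.
Proof.
move=> p0 q0; rewrite size_mul ?expf_neq0 // expr2 size_mul //.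
move: p0; rewrite -size_poly_gt0; case: (size p) => // k _.
by rewrite /= -addnn addnS.
Qed.

Theorem biquadratic_case f f1 m m1 Z Z1 e :
  separable_poly f -> separable_poly f1 -> size f = e.*2.+1 -> size f1 = e.*2.+1 ->
  (2 <= e)%N -> mE m != 0 -> mE m1 != 0 ->
  rat_inverse f f1 m m1 Z -> rat_inverse f1 f m1 m Z1 -> mB m != 0 ->
  [/\ mB m1 != 0, e = 2%N & polyI f ^+ 3 * polyD f1 = polyI f1 ^+ 3 * polyD f].
Proof.
move=> sepf sepf1 sf sf1 e2 E0 E10 inv inv1 B0.
have lf : (1 < size f)%N by rewrite sf; lia.
have lf1 : (1 < size f1)%N by rewrite sf1; lia.
have [F [pF F0 sF sYF Fv]] := relation_degree sepf lf E0 E10 inv.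
have [Z0 _] := inv; have [Z10 inv1'] := inv1.
have sF3 : (size F <= 3)%N by rewrite sF B0.
have [V V0 dV] : exists2 V, V != 0 & discX F = V ^+ 2 * f.
  apply: (relation_discriminant sepf lf E0 B0 Z0 F0 sF3 two_neq0).
  by move=> x y yf _ Ex; exact: Fv.
have V20 : V ^+ 2 != 0 by rewrite expf_neq0.
have f0 : f != 0 by rewrite -size_poly_gt0 sf.
have f10 : f1 != 0 by rewrite -size_poly_gt0 sf1.
have sd : size (discX F) = ((size V).-1.*2 + e.*2.+1)%N.
  by rewrite dV size_sq_mul // sf.
(* Otherwise [F] has degree at most one in [x], and its discriminant, of degree at most [2], cannot
   be a multiple of [f], of degree at least [4]. *)
have B10 : mB m1 != 0.
  apply: contraTneq isT => B10; move: sYF; rewrite B10 eqxx => /size_discX.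
  rewrite sd addnS ltnS leqNgt; case/negP; apply: leq_trans (leq_addl _ _).
  by rewrite -(leq_double 2) in e2; apply: leq_trans e2.
move: sYF; rewrite B10 => sYF; have := size_discX sYF; rewrite sd => le4.
have [eE sV] : e = 2%N /\ size V = 1%N.
  by apply: degree_count e2 le4; rewrite size_poly_gt0.
have /size_poly1P [v v0 vE] : size V == 1%N by rewrite sV.
split=> //.
have ssF : (size (swapXY F) <= 3)%N by rewrite -sizeYE.
(* With the variables exchanged, [F] is a relation satisfied by [x] as a function on the second
   curve. *)
have [V1 V10 dV1] : exists2 V, V != 0 & discX (swapXY F) = V ^+ 2 * f1.
  apply: (relation_discriminant sepf1 lf1 E10 B10 Z10 _ ssF two_neq0).
    by rewrite swapXY_eq0.
  move=> t y yf Zt _; rewrite horner2_swapXY -/(mX m1 t y).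
  have [_ yE Ex tE _] := inv1' t y yf Zt.
  by rewrite -{1}tE; apply: Fv.
have /size_poly1P [v1 v10 v1E] : size V1 == 1%N.
  have sY3 : (sizeY (swapXY F) <= 3)%N by rewrite sizeYE swapXYK.
  have := size_discX sY3; rewrite dV1 size_sq_mul // sf1 => /degree_count[] //.
    by rewrite size_poly_gt0.
  by move=> _ ->.
have [] := polyI_discX_swap sF3 sYF.
rewrite dV dV1 vE v1E -!polyC_exp !mul_polyC !polyI_scale !polyD_scale => HI HD.
(* [I ^+ 3] and [D] both scale by the sixth power of the factor, which is [v ^+ 2] or [v1 ^+ 2]. *)
apply: (mulfI (expf_neq0 12 v0)); apply: (mulfI (expf_neq0 12 v10)).
transitivity (((v ^+ 2) ^+ 2 * polyI f) ^+ 3 * ((v1 ^+ 2) ^+ 6 * polyD f1)); first by ring.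
by rewrite HD -HI; ring.
Qed.
End Correspondence.

(** * Moebius correspondences *)

Section Moebius.
Variable L : closedFieldType.
Hypothesis two_neq0 : (2%:R : L) != 0.
Implicit Types (f p q : {poly L}) (F : {poly {poly L}}).

Definition homogenize n f p q : {poly L} :=
  \sum_(k < n.+1) f`_k *: (p ^+ k * q ^+ (n - k)).

Lemma horner_homogenize n f p q x : (size f <= n.+1)%N -> q.[x] != 0 ->
  (homogenize n f p q).[x] = q.[x] ^+ n * f.[p.[x] / q.[x]].
Proof.
move=> sf qx; rewrite (horner_coef_wide _ sf) mulr_sumr horner_sum.
apply: eq_bigr => -[k /= kn] _; rewrite !horner_ringE.
rewrite -[in RHS](subnK (kn : (k <= n)%N)) exprD exprMn exprVn.
have qk : q.[x] ^+ k != 0 by rewrite expf_neq0.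
by field.
Qed.

Lemma horner_homogenize_pole n f p q x : q.[x] = 0 ->
  (homogenize n f p q).[x] = f`_n * p.[x] ^+ n.
Proof.
move=> qx; rewrite horner_sum big_ord_recr /= big1 ?add0r => [|[k /= kn] _].
  by rewrite subnn expr0 mulr1 !horner_ringE.
by rewrite !horner_ringE qx expr0n subn_eq0 leqNgt kn !mulr0.
Qed.

Definition moebius_roots f f1 := exists a b c d : L, a * d - b * c != 0 /\
  forall r, f.[r] = 0 ->
    c * r + d != 0 /\ f1.[(a * r + b) / (c * r + d)] = 0.

(** [F] now has degree at most one in each variable, so [X = l1 / l2]. In [Y^2 = f1(X)] the part in
    [y] gives [C D = 0], hence [C = 0], and the rest makes the homogenization of [f1] at [(l1, l2)]
    a square times [f]. *)
Lemma moebius_case f f1 m m1 Z e :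
  separable_poly f -> size f = e.*2.+1 -> size f1 = e.*2.+1 ->
  (2 <= e)%N -> mE m != 0 -> mE m1 != 0 -> mB m = 0 -> mB m1 = 0 ->
  rat_inverse f f1 m m1 Z -> moebius_roots f f1.
Proof.
move=> sepf sf sf1 e2 E0 E10 B0 B10 inv.
have lf : (1 < size f)%N by rewrite sf ltnS double_gt0 (leq_trans _ e2).
have f0 : f != 0 by rewrite -size_poly_gt0 sf.
have [F [_ F0 sF sYF Fv]] := relation_degree sepf lf E0 E10 inv.
have [Z0 inv'] := inv.
have {}inv' x y : y ^+ 2 = f.[x] -> Z.[x] != 0 ->
   [/\ (mE m).[x] != 0, mY m x y ^+ 2 = f1.[mX m x y],
     mX m1 (mX m x y) (mY m x y) = x & mY m1 (mX m x y) (mY m x y) = y].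
  by move=> yf Zx; case: (inv' x y yf Zx).
move: sF sYF; rewrite B0 B10 eqxx => sF sYF.
have sc i : (size (F`_i)%R <= 2)%N by apply: leq_trans (max_size_coefXY _ _) sYF.
set d := F`_1`_0; set c := F`_1`_1; set a := - F`_0`_1; set b := - F`_0`_0.
have P1E : F`_1 = c *: 'X + d%:P.
  apply/polyP => -[|[|i]]; rewrite coefD coefZ coefX coefC /= ?mulr0 ?mulr1 ?add0r ?addr0 //.
  by rewrite nth_default // (leq_trans (sc _)).
have P0E : - F`_0 = a *: 'X + b%:P.
  apply/polyP => -[|[|i]]; rewrite coefD coefN coefZ coefX coefC /= ?mulr0 ?mulr1 ?add0r ?addr0 //.
  by rewrite nth_default ?oppr0 // (leq_trans (sc _)).
have P10 : F`_1 != 0 by move: F0; rewrite -lead_coef_eq0 lead_coefE sF.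
set l1 := a *: 'X + b%:P in P0E; set l2 := c *: 'X + d%:P in P1E.
have l20 : l2 != 0 by rewrite -P1E.
have l1x x : l1.[x] = a * x + b by rewrite !horner_ringE.
have l2x x : l2.[x] = c * x + d by rewrite !horner_ringE.
have XE x y : y ^+ 2 = f.[x] -> Z.[x] != 0 -> l2.[x] != 0 -> mX m x y = l1.[x] / l2.[x].
  move=> yf Zx l2x0; have [Ex _ _ _] := inv' x y yf Zx.
  have := Fv x y yf Ex; rewrite horner2_small ?sF // (nth_default _ (_ : size F <= 2)%N) ?sF //.
  rewrite horner0 mul0r addr0 -P0E P1E hornerN => /eqP; rewrite addr_eq0 => /eqP ->.
  by field.
(* With zero determinant [X] would be a constant [la], and [x], which is a function of [X], would be
   constant too. *)
have det0 : a * d - b * c != 0.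
  apply: contraTneq isT => /eqP; rewrite subr_eq0 => /eqP adbc.
  pose la := if c == 0 then b / d else a / c.
  have laE x : l2.[x] != 0 -> l1.[x] / l2.[x] = la.
    rewrite l1x l2x /la; have [c0|c0] := eqVneq c 0.
      rewrite c0 mul0r add0r => d0; move/eqP: adbc.
      by rewrite c0 mulr0 mulf_eq0 (negPf d0) orbF => /eqP ->; rewrite mul0r add0r.
    move=> cd; apply/eqP; rewrite eqr_div //; apply/eqP.
    by rewrite mulrDl mulrDr [b * c]mulrC adbc [a * (c * x)]mulrCA; ring: adbc.
  pose x0 := (mA m1).[la] / (mE m1).[la].
  have : 'X - x0%:P = 0.
    apply: (@poly_horner_ae_eq0 _ (Z * l2)); first by rewrite mulf_neq0.
    move=> x; rewrite hornerM mulf_eq0 negb_or => /andP[Zx lx].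
    have [y yf] := closed_sqrt f.[x]; have [_ _ xE _] := inv' x y yf Zx.
    rewrite hornerXsubC -xE (XE x y yf Zx lx) laE // /mX /rat_xy B10 horner0.
    by rewrite mul0r addr0 subrr.
  by move/eqP; rewrite polyXsubC_eq0.
exists a, b, c, d; split=> // r fr.
(* Otherwise [(x, y)] and [(x, - y)] would have the same image. *)
have D0 : mD m != 0.
  apply: contraTneq isT => D0.
  have [x] := poly_nonroot (mulf_neq0 Z0 f0).
  rewrite hornerM mulf_eq0 negb_or => /andP[Zx fx].
  have [y yf] := closed_sqrt f.[x].
  have yf' : (- y) ^+ 2 = f.[x] by rewrite sqrrN.
  have [_ _ _ y1] := inv' x y yf Zx; have [_ _ _ y2] := inv' x _ yf' Zx.
  have : y = - y.
    by rewrite -{1}y1 -[in RHS]y2 /mX /mY /rat_xy B0 D0 !horner0 !mul0r.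
  move/eqP; rewrite -subr_eq0 opprK -mulr2n -mulr_natr mulf_eq0 (negPf two_neq0) orbF.
  by move=> /eqP y0; move: fx; rewrite -yf y0 expr0n eqxx.
pose H := homogenize e.*2 f1 l1 l2.
have [||] := @curve_fun_eq0 L f (Z * l2)
   (l2 ^+ e.*2 * (mC m ^+ 2 + mD m ^+ 2 * f) - mE m ^+ 2 * H)
   (l2 ^+ e.*2 * (mC m * mD m) *+ 2) sepf lf; first by rewrite mulf_neq0.
  move=> x y yf; rewrite hornerM mulf_eq0 negb_or => /andP[Zx lx].
  have [Ex Y2 _ _] := inv' x y yf Zx.
  rewrite hornerD hornerN [(_ * H).[x]]hornerM horner_homogenize ?sf1 //.
  rewrite -(XE x y yf Zx lx) -Y2 /mY /rat_xy !horner_ringE -yf.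
  by move: Ex (_ ^+ e.*2); clear; move=> Ex u; field.
move=> /eqP; rewrite subr_eq0 => /eqP H1 /eqP.
rewrite -mulr_natr !mulf_eq0 (negPf D0) expf_eq0 (negPf l20) andbF /= orbF.
rewrite -polyC_natr polyC_eq0 (negPf two_neq0) orbF => /eqP C0.
move: H1; rewrite C0 expr0n add0r mulrA -muln2 exprM -exprMn => /esym H1.
have [V [_ HV]] := separable_sq_dvd sepf E0 H1.
have Hr : H.[r] = 0 by rewrite HV hornerM fr mulr0.
(* At a pole the homogenization is [lead_coef f1] times a power of [l1.[r]], so [l1] and [l2] would
   share the root [r], against the determinant. *)
rewrite -l2x -l1x; have [l2r|l2r] := eqVneq l2.[r] 0.
  move: Hr; rewrite horner_homogenize_pole // => /eqP; rewrite mulf_eq0.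
  have -> : f1`_e.*2 = lead_coef f1 by rewrite lead_coefE sf1.
  rewrite lead_coef_eq0 -size_poly_eq0 sf1 expf_eq0 => /andP[_ /eqP l1r].
  case/eqP: det0; transitivity (a * l2.[r] - c * l1.[r]); last by rewrite l2r l1r !mulr0 subrr.
  by rewrite l1x l2x; ring.
split=> //; move: Hr; rewrite horner_homogenize ?sf1 // => /eqP.
by rewrite mulf_eq0 expf_eq0 (negPf l2r) andbF => /eqP.
Qed.
End Moebius.

(** * Projective morphisms *)

Section Mpoly.
Variable R : fieldType.

Lemma meval_dhomog_scale n d (q : {mpoly R[n]}) (a : R) (v : 'I_n -> R) :
  q \is d.-homog -> q.@[fun i => a * v i] = a ^+ d * q.@[v].
Proof.
move=> /dhomogP hq; rewrite !mevalE mulr_sumr; apply: eq_big_seq => m /hq /= <-.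
rewrite mulrCA; congr (_ * _); rewrite mdegE -prodrXr -big_split /=.
by apply: eq_bigr => i _; rewrite exprMn.
Qed.

Lemma dhomog_prod_exp n k d (P : 'I_k -> {mpoly R[n]}) (m : 'X_{1..k}) :
  (forall j, P j \is d.-homog) ->
  \prod_(i < k) P i ^+ m i \is (d * mdeg m)%N.-homog.
Proof.
move=> hP; rewrite mdegE big_distrr /=.
elim/big_rec2: _ => [|i a b _ IH]; first exact: dhomog1.
by apply: dhomogM IH; rewrite dhomogMn.
Qed.

Lemma dhomog_comp n k d e (P : 'I_k -> {mpoly R[n]}) (q : {mpoly R[k]}) :
  (forall j, P j \is d.-homog) -> q \is e.-homog ->
  q \mPo [tuple P j | j < k] \is (d * e)%N.-homog.
Proof.
move=> hP /dhomogP hq; rewrite comp_mpolyEX big_seq; apply: rpred_sum => m mq.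
apply: dhomogZ; rewrite comp_mpolyX.
under eq_bigr do rewrite tnth_mktuple.
by rewrite -(hq m mq); exact: dhomog_prod_exp.
Qed.

End Mpoly.

Lemma meval_map_mpoly (K R : fieldType) (f : {rmorphism K -> R}) n (q : {mpoly K[n]}) v :
  (map_mpoly f q).@[fun i => f (v i)] = f q.@[v].
Proof.
elim/mpolyind: q => [|c m q _ _ IH]; first by rewrite !rmorph0.
rewrite rmorphD /= map_mpolyZ map_mpolyX !mevalD !mevalZ !mevalX IH rmorphD rmorphM rmorph_prod.
by under [in RHS]eq_bigr do rewrite rmorphXn.
Qed.

Section Morphisms.
Variable L : closedFieldType.

Definition mevals n k (P : 'I_k -> {mpoly L[n.+1]}) (x : 'rV[L]_n.+1) : 'rV[L]_k :=
  \row_j (P j).@[x 0].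

Lemma proj_eq_sym n (x y : 'rV[L]_n.+1) : proj_eq x y -> proj_eq y x.
Proof. by case=> a a0 ->; exists a^-1; rewrite ?invr_neq0 // scalerA mulVf // scale1r. Qed.

Lemma proj_eq_trans n (y x z : 'rV[L]_n.+1) : proj_eq x y -> proj_eq y z -> proj_eq x z.
Proof.
by case=> a a0 ->; case=> b b0 ->; exists (b * a); rewrite ?mulf_neq0 // scalerA.
Qed.

Lemma mevals_scale n k d (P : 'I_k -> {mpoly L[n.+1]}) (x : 'rV[L]_n.+1) a :
  (forall j, P j \is d.-homog) -> mevals P (a *: x) = a ^+ d *: mevals P x.
Proof.
move=> hP; apply/rowP => j; rewrite !mxE -(meval_dhomog_scale _ _ (hP j)).
by apply: meval_eq => i; rewrite mxE.
Qed.

(** Both points lie in the domain of one local formula, whose homogeneity turns the factor [a] into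
    [a ^+ d]. *)
Lemma proj_morphism_eq n m (E : seq {mpoly L[n.+1]}) (F : seq {mpoly L[m.+1]}) f x y :
  proj_morphism E F f -> x \in zeros E -> y \in zeros E -> proj_eq x y ->
  proj_eq (f x) (f y).
Proof.
move=> [_ hf] xE yE [a a0 yx]; have [d [P [hP Px Pf]]] := hf x xE.
have Py : mevals P y = a ^+ d *: mevals P x by rewrite yx (mevals_scale _ _ hP).
have Py0 : mevals P y != 0 by rewrite Py scaler_eq0 negb_or expf_neq0.
apply: (proj_eq_trans (Pf x xE Px)).
apply: proj_eq_trans (proj_eq_sym (Pf y yE Py0)).
by exists (a ^+ d); rewrite ?expf_neq0.
Qed.

Lemma proj_morphism_comp n m k (E : seq {mpoly L[n.+1]}) (F : seq {mpoly L[m.+1]})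
    (G : seq {mpoly L[k.+1]}) f g :
  proj_morphism E F f -> proj_morphism F G g -> proj_morphism E G (g \o f).
Proof.
move=> [fEF hf] [gFG hg]; split=> [x /fEF/gFG //|x xE].
have [d [P [hP Px Pf]]] := hf x xE.
have [e [Q [hQ Qx Qg]]] := hg (f x) (fEF x xE).
have /rV0Pn[i fxi] : f x != 0 by have := fEF x xE; rewrite unfold_in => /andP[].
(* The factor [X_i] makes the degree positive, so that [R] vanishes where [P] does. *)
pose R j := 'X_i * Q j.
have hR j : R j \is e.+1.-homog.
  have X1 : ('X_i : {mpoly L[m.+1]}) \is 1.-homog by rewrite dhomogX /= mdeg1.
  exact: (dhomogM X1 (hQ j)).
have RE z : mevals R z = z 0 i *: mevals Q z.
  by apply/rowP => j; rewrite !mxE mevalM mevalXU.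
pose S j := R j \mPo [tuple P l | l < m.+1].
have SE z : mevals S z = mevals R (mevals P z).
  apply/rowP => j; rewrite !mxE comp_mpoly_meval; apply: meval_eq => l.
  by rewrite tnth_mktuple mxE.
exists (d * e.+1)%N, S; split=> [j||x' x'E].
- exact: dhomog_comp.
- have [a a0] := Pf x xE Px; rewrite -/(mevals S x) SE -/(mevals P x) => ->.
  rewrite (mevals_scale _ _ hR) RE !scaler_eq0 !negb_or expf_neq0 // fxi /=.
  exact: Qx.
rewrite -/(mevals S x') SE => Sx'.
have Px' : mevals P x' != 0.
  apply: contraNneq Sx' => ->; rewrite -(scale0r (0 : 'rV_m.+1)).
  by rewrite (mevals_scale _ _ hR) expr0n scale0r.
have [a a0 PE] := Pf x' x'E Px'; move: Sx'; rewrite -/(mevals P x') in PE *.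
rewrite PE (mevals_scale _ _ hR) RE scalerA => Sx'.
have := Sx'; rewrite scaler_eq0 negb_or => /andP[b0 Qx'].
have [b b1 QE] := Qg _ (fEF _ x'E) Qx'; rewrite -/(mevals Q _) in QE; rewrite QE.
by exists (a ^+ e.+1 * f x' 0 i * b); [exact: mulf_neq0 | rewrite -[RHS]scalerA].
Qed.

Lemma proj_isomorphic_sym n m (E : seq {mpoly L[n.+1]}) (F : seq {mpoly L[m.+1]}) :
  proj_isomorphic E F -> proj_isomorphic F E.
Proof. by move=> [f [g [? ? ? ?]]]; exists g, f. Qed.

Lemma proj_isomorphic_trans n m k (E : seq {mpoly L[n.+1]}) (F : seq {mpoly L[m.+1]})
    (G : seq {mpoly L[k.+1]}) :
  proj_isomorphic E F -> proj_isomorphic F G -> proj_isomorphic E G.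
Proof.
move=> [f [f' [hf hf' ff' f'f]]] [g [g' [hg hg' gg' g'g]]].
exists (g \o f), (f' \o g'); split.
- exact: proj_morphism_comp hf hg.
- exact: proj_morphism_comp hg' hf'.
- move=> x xE; apply: proj_eq_trans (ff' x xE) => /=.
  have fx : f x \in zeros F by case: hf => + _; exact.
  apply: (proj_morphism_eq hf' _ fx (gg' _ fx)).
  by case: hg' => + _; apply; case: hg => + _; exact.
move=> y yG; apply: proj_eq_trans (g'g y yG) => /=.
have gy : g' y \in zeros F by case: hg' => + _; exact.
apply: (proj_morphism_eq hg _ gy (f'f _ gy)).
by case: hf => + _; apply; case: hf' => + _; exact.
Qed.

(** * Conjugation by a field automorphism *)

Section Conjugate.
Variables (s : {rmorphism L -> L}) (t : L -> L).
Hypotheses (sK : cancel s t) (tK : cancel t s).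

Lemma mevals_map n k (P : 'I_k -> {mpoly L[n.+1]}) (x : 'rV[L]_n.+1) :
  mevals (fun j => map_mpoly s (P j)) x = map_mx s (mevals P (map_mx t x)).
Proof.
apply/rowP => j; rewrite !mxE -meval_map_mpoly; apply: meval_eq => i.
by rewrite mxE tK.
Qed.

Lemma map_mxsK n : cancel (@map_mx _ _ s 1 n) (map_mx t).
Proof. by move=> x; apply/rowP => j; rewrite !mxE sK. Qed.

Lemma map_mxtK n : cancel (@map_mx _ _ t 1 n) (map_mx s).
Proof. by move=> x; apply/rowP => j; rewrite !mxE tK. Qed.

Lemma zeros_conj n (E : seq {mpoly L[n.+1]}) x :
  (x \in zeros (base_change s E)) = (map_mx t x \in zeros E).
Proof.
rewrite !unfold_in all_map; congr (_ && _).
  by rewrite -{1}(map_mxtK x) map_mx_eq0.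
apply: eq_all => q /=; rewrite -[RHS](fmorph_eq0 s) -meval_map_mpoly.
by congr (_ == 0); apply: meval_eq => i; rewrite mxE tK.
Qed.

Lemma proj_eq_map n (x y : 'rV[L]_n.+1) : proj_eq x y -> proj_eq (map_mx s x) (map_mx s y).
Proof. by case=> a a0 ->; exists (s a); rewrite ?fmorph_eq0 // map_mxZ. Qed.

Definition conj_map n m (f : 'rV[L]_n.+1 -> 'rV[L]_m.+1) x := map_mx s (f (map_mx t x)).

Lemma proj_morphism_conj n m (E : seq {mpoly L[n.+1]}) (F : seq {mpoly L[m.+1]}) f :
  proj_morphism E F f ->
  proj_morphism (base_change s E) (base_change s F) (conj_map f).
Proof.
move=> [fEF hf]; split=> x; rewrite zeros_conj => xE.
  by rewrite zeros_conj /conj_map map_mxsK; exact: fEF.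
have [d [P [hP Px Pf]]] := hf _ xE.
exists d, (fun j => map_mpoly s (P j)); split=> [j||x'].
- apply/dhomogP => m0; rewrite (perm_mem (msupp_map_mpoly _ _)) //; last exact: fmorph_inj.
  by move/dhomogP: (hP j); exact.
- by rewrite -/(mevals _ x) mevals_map map_mx_eq0.
rewrite zeros_conj -/(mevals _ x') mevals_map map_mx_eq0 => x'E Px'.
exact: proj_eq_map (Pf _ x'E Px').
Qed.

Lemma proj_isomorphic_conj n m (E : seq {mpoly L[n.+1]}) (F : seq {mpoly L[m.+1]}) :
  proj_isomorphic E F -> proj_isomorphic (base_change s E) (base_change s F).
Proof.
move=> [f [g [hf hg gf fg]]]; exists (conj_map f), (conj_map g); split.
- exact: proj_morphism_conj.
- exact: proj_morphism_conj.
- move=> x; rewrite zeros_conj => xE; rewrite -{2}(map_mxtK x) /conj_map map_mxsK.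
  exact: proj_eq_map (gf _ xE).
move=> x; rewrite zeros_conj => xE; rewrite -{2}(map_mxtK x) /conj_map map_mxsK.
exact: proj_eq_map (fg _ xE).
Qed.

Lemma base_change_fixed n (E : seq {mpoly L[n.+1]}) :
  (forall q, q \in E -> forall k, s q@_k = q@_k) -> base_change s E = E.
Proof.
move=> fixE; rewrite /base_change -[RHS]map_id; apply/eq_in_map => q qE.
by apply/mpolyP => k; rewrite mcoeff_map_mpoly; exact: fixE.
Qed.

End Conjugate.
End Morphisms.

(** * The hyperelliptic model *)

(** The hyperelliptic model with [e] and [N] as free parameters, so that the ambient space does not
    depend on [size f] and stays the same under base change. *)
Definition scroll_model (K : fieldType) (e N : nat) (f : {poly K}) : seq {mpoly K[e.+2]} :=
  let X (i : nat) : {mpoly K[e.+2]} := 'X_(inord i) in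
  (X e.+1 ^+ 2 - \sum_(k < N) f`_k *: (X k./2 * X (uphalf k)))
  :: [seq X i * X j.+1 - X i.+1 * X j | i <- iota 0 e, j <- iota 0 e].

Lemma hyperellipticE (K : fieldType) (f : {poly K}) :
  hyperelliptic f = scroll_model (size f)./2 (size f) f.
Proof. by []. Qed.

Lemma base_change_scroll (K : fieldType) (L : closedFieldType) (iota : {rmorphism K -> L}) e N f :
  base_change iota (scroll_model e N f) = scroll_model e N (map_poly iota f).
Proof.
have mX i : map_mpoly iota ('X_i : {mpoly K[e.+2]}) = 'X_i by rewrite map_mpolyX.
rewrite /base_change /scroll_model /= rmorphB rmorphXn /= mX.
have mS (c : 'I_N -> K) (P : 'I_N -> {mpoly K[e.+2]}) :
    map_mpoly iota (\sum_k c k *: P k) = \sum_k iota (c k) *: map_mpoly iota (P k).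
  by rewrite rmorph_sum; apply: eq_bigr => k _; exact: map_mpolyZ.
congr (_ :: _).
  rewrite mS; congr (_ - _); apply: eq_bigr => k _.
  by rewrite coef_map rmorphM /= !mX.
rewrite map_allpairs; apply/eq_in_allpairs => i j _ _ /=.
by rewrite rmorphB !rmorphM /= !mX.
Qed.

Section ScrollModel.
Variables (L : closedFieldType) (e : nat).
Implicit Types (f : {poly L}) (x y t : L) (z : 'rV[L]_e.+2).

Definition crd z (i : nat) : L := z 0 (inord i).

Lemma scroll_zerosP N f z : reflect
  [/\ z != 0, crd z e.+1 ^+ 2 = \sum_(k < N) f`_k * (crd z k./2 * crd z (uphalf k)) &
      forall i j, (i < e)%N -> (j < e)%N -> crd z i * crd z j.+1 = crd z i.+1 * crd z j]
  (z \in zeros (scroll_model e N f)).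
Proof.
have ev0 : ('X_(inord e.+1) ^+ 2 - \sum_(k < N) f`_k *: ('X_(inord k./2) * 'X_(inord (uphalf k)))
      : {mpoly L[e.+2]}).@[z 0]
    = crd z e.+1 ^+ 2 - \sum_(k < N) f`_k * (crd z k./2 * crd z (uphalf k)).
  rewrite mevalB rmorphXn /= mevalXU (big_morph _ (mevalD _) (meval0 _)); congr (_ - _).
  by apply: eq_bigr => k _; rewrite mevalZ mevalM !mevalXU.
rewrite unfold_in /= ev0 subr_eq0.
apply: (iffP and3P) => [[z0 /eqP z1 /allP z2]|[z0 z1 z2]]; split=> //.
- move=> i j ie je; apply/eqP; rewrite -subr_eq0.
  have := z2 ('X_(inord i) * 'X_(inord j.+1) - 'X_(inord i.+1) * 'X_(inord j)).
  rewrite mevalB !mevalM !mevalXU; apply.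
  by apply/allpairsP; exists (i, j); rewrite !mem_iota.
- exact/eqP.
apply/allP => q /allpairsP[[i j] /=]; rewrite !mem_iota /= => -[ie je ->].
by rewrite mevalB !mevalM !mevalXU -/(crd z i) z2 // subrr.
Qed.

Definition affine_pt x y : 'rV[L]_e.+2 :=
  \row_j (if (j <= e)%N then x ^+ j else y).

Definition infinite_pt b : 'rV[L]_e.+2 :=
  \row_j (if j == e :> nat then 1 else if j == e.+1 :> nat then b else 0).

Lemma crd_affine x y i : (i <= e)%N -> crd (affine_pt x y) i = x ^+ i.
Proof. by move=> ie; rewrite /crd mxE inordK ?ie // ltnS ltnW. Qed.

Lemma crd_affineY x y : crd (affine_pt x y) e.+1 = y.
Proof. by rewrite /crd mxE inordK // ltnn. Qed.

Lemma crd_inf b i : (i < e)%N -> crd (infinite_pt b) i = 0.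
Proof. by move=> ie; rewrite /crd mxE inordK; [|lia]; rewrite !ltn_eqF // ltnW. Qed.

Lemma crd_infX b : crd (infinite_pt b) e = 1.
Proof. by rewrite /crd mxE inordK // eqxx. Qed.

Lemma crd_infY b : crd (infinite_pt b) e.+1 = b.
Proof. by rewrite /crd mxE inordK // eqxx gtn_eqF. Qed.

Lemma crdP z z' : (forall i, (i <= e)%N -> crd z i = crd z' i) ->
  crd z e.+1 = crd z' e.+1 -> z = z'.
Proof.
move=> H HY; apply/rowP => j; rewrite -(inord_val j).
have := ltn_ord j; rewrite ltnS leq_eqVlt => /predU1P[->|]; first exact: HY.
exact: H.
Qed.

Lemma crdZ a z i : crd (a *: z) i = a * crd z i.
Proof. by rewrite /crd mxE. Qed.

Lemma crd_neq0 z i : crd z i != 0 -> z != 0.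
Proof. by apply: contraNneq => ->; rewrite /crd mxE. Qed.

Lemma half_uphalf k : (k./2 + uphalf k = k)%N.
Proof. by rewrite uphalf_half addnCA addnn odd_double_half. Qed.

Lemma affine_zeros N f x y : (size f <= N)%N -> (N <= e.*2.+1)%N ->
  (affine_pt x y \in zeros (scroll_model e N f)) = (y ^+ 2 == f.[x]).
Proof.
move=> sf Ne; have sumE : \sum_(k < N) f`_k * (crd (affine_pt x y) k./2 * crd (affine_pt x y) (uphalf k))
    = f.[x].
  rewrite (horner_coef_wide _ sf); apply: eq_bigr => k _; congr (_ * _).
  have kN := ltn_ord k; rewrite !crd_affine -?exprD ?half_uphalf //; lia.
apply/scroll_zerosP/eqP => [[_]|yf]; rewrite sumE crd_affineY //; split=> //.
  by apply: (@crd_neq0 _ 0%N); rewrite crd_affine // oner_eq0.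
by move=> i j ie je; rewrite !crd_affine ?(ltnW ie) ?(ltnW je) // -!exprD addSnnS.
Qed.

Lemma infinite_zeros f b : b ^+ 2 = f`_e.*2 ->
  infinite_pt b \in zeros (scroll_model e e.*2.+1 f).
Proof.
move=> bf; apply/scroll_zerosP; split.
- by apply: (@crd_neq0 _ e); rewrite crd_infX oner_eq0.
- rewrite crd_infY big_ord_recr /= big1 => [|k _].
    by rewrite add0r doubleK uphalf_double crd_infX !mulr1.
  by rewrite (@crd_inf b k./2) ?mul0r ?mulr0 //; have := ltn_ord k; lia.
by move=> i j ie je; rewrite (crd_inf b ie) (crd_inf b je) mul0r mulr0.
Qed.

(** The minors [X_0 X_(i+1) = X_1 X_i] give [X_i / X_0 = (X_1 / X_0)^i] by induction. *)
Lemma scroll_affine N f z : z \in zeros (scroll_model e N f) -> crd z 0 != 0 ->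
  proj_eq z (affine_pt (crd z 1 / crd z 0) (crd z e.+1 / crd z 0)).
Proof.
move=> /scroll_zerosP[_ _ hz] z0; exists (crd z 0)^-1; rewrite ?invr_neq0 //.
apply: crdP => [i|]; rewrite crdZ; last by rewrite crd_affineY mulrC.
move=> ie; rewrite crd_affine //; elim: i ie => [|i IH] ie; first by rewrite expr0 mulVf.
rewrite exprS IH ?(ltnW ie) //.
have h := hz 0%N i (leq_ltn_trans (leq0n i) ie) ie.
have -> : crd z i.+1 = crd z 1 * crd z i / crd z 0 by rewrite -h mulrC mulKf.
by ring.
Qed.

(** The minors [X_i X_(i+2) = X_(i+1)^2] propagate the vanishing of [X_0] up to [X_(e-1)], and the
    remaining equation reduces to [Y^2 = f_(2e) X_e^2]. *)
Lemma scroll_infinite f z : (0 < e)%N -> z \in zeros (scroll_model e e.*2.+1 f) -> crd z 0 = 0 ->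
  exists2 b, b ^+ 2 = f`_e.*2 & proj_eq z (infinite_pt b).
Proof.
move=> e0 /scroll_zerosP[nz hY hz] z0.
have zi i : (i < e)%N -> crd z i = 0.
  elim: i => [|i IH] // ie; have := hz i i.+1 (ltnW ie) ie.
  by rewrite IH ?(ltnW ie) // mul0r => /esym/eqP; rewrite mulf_eq0 orbb => /eqP.
have {}hY : crd z e.+1 ^+ 2 = f`_e.*2 * crd z e ^+ 2.
  rewrite hY big_ord_recr /= big1 => [|k _]; first by rewrite add0r doubleK uphalf_double.
  by rewrite (zi k./2) ?mul0r ?mulr0 //; have := ltn_ord k; lia.
have ze : crd z e != 0.
  apply: contraNneq nz => ze; apply/eqP/crdP => [i|].
    rewrite leq_eqVlt => /predU1P[->|/zi ->]; by rewrite ?ze /crd mxE.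
  by move/eqP: hY; rewrite ze expr0n mulr0 expf_eq0 => /eqP ->; rewrite /crd mxE.
exists (crd z e.+1 / crd z e); first by rewrite expr_div_n hY mulfK // expf_neq0.
exists (crd z e)^-1; rewrite ?invr_neq0 //; apply: crdP => [i|]; rewrite crdZ.
  rewrite leq_eqVlt => /predU1P[->|ie]; first by rewrite crd_infX mulVf.
  by rewrite (zi _ ie) (crd_inf _ ie) mulr0.
by rewrite crd_infY mulrC.
Qed.

Lemma proj_eq_ratio z z' i : proj_eq z z' -> crd z' i / crd z' 0 = crd z i / crd z 0.
Proof. by case=> a a0 ->; rewrite !crdZ -mulf_div divff // mul1r. Qed.

Lemma proj_eq_crd0 z z' : proj_eq z z' -> (crd z' 0 == 0) = (crd z 0 == 0).
Proof. by case=> a a0 ->; rewrite !crdZ mulf_eq0 (negPf a0). Qed.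

Lemma affine_proj_inj x y x' y' : (0 < e)%N ->
  proj_eq (affine_pt x y) (affine_pt x' y') -> x = x' /\ y = y'.
Proof.
move=> e0 H; have := proj_eq_ratio 1 H; have := proj_eq_ratio e.+1 H.
by rewrite !crd_affineY !crd_affine // !expr0 !divr1 !expr1 => -> ->.
Qed.

(** Powers of [y] reduce by [y ^+ 2 = f.[x]], so the regular functions on the affine chart form
    [L[x] + L[x] y]. *)
Lemma meval_affine f (P : {mpoly L[e.+2]}) : exists ab : {poly L} * {poly L},
  forall x y, y ^+ 2 = f.[x] -> P.@[affine_pt x y 0] = ab.1.[x] + ab.2.[x] * y.
Proof.
pose S (P : {mpoly L[e.+2]}) := exists ab : {poly L} * {poly L},
  forall x y, y ^+ 2 = f.[x] -> P.@[affine_pt x y 0] = ab.1.[x] + ab.2.[x] * y.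
have S1 : S 1 by exists (1, 0) => x y _; rewrite meval1 !hornerE.
have SM P1 P2 : S P1 -> S P2 -> S (P1 * P2).
  move=> [[a b] H1] [[c d] H2]; exists (a * c + b * d * f, a * d + b * c) => x y yf.
  by rewrite mevalM H1 // H2 //= !horner_ringE -yf; ring.
have SX m : S 'X_[m].
  rewrite mpolyXE_id; elim/big_ind: _ => // i _.
  elim: (m i) => [|k IH]; rewrite ?expr0 // exprS; apply: SM => //.
  have [ie|ie] := leqP i e.
    by exists ('X^i, 0) => x y _ /=; rewrite mevalXU mxE ie hornerXn !horner_ringE mul0r addr0.
  by exists (0, 1) => x y _ /=; rewrite mevalXU mxE leqNgt ie !horner_ringE mul1r add0r.
elim/mpolyind: P => [|c m P _ _ [[a b] IH]].
  by exists (0, 0) => x y _; rewrite meval0 !horner_ringE mul0r addr0.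
have [[a' b'] H] := SX m; exists (c *: a' + a, c *: b' + b) => x y yf.
by rewrite mevalD mevalZ H // IH //= !horner_ringE; ring.
Qed.
End ScrollModel.

(** * Isomorphisms of hyperelliptic models *)

Section ScrollIsomorphism.
Variables (L : closedFieldType) (e : nat).
Hypothesis two_neq0 : (2%:R : L) != 0.
Hypothesis e_ge2 : (2 <= e)%N.
Let N := e.*2.+1.
Let e_gt0 : (0 < e)%N := ltnW e_ge2.
Implicit Types (f : {poly L}) (x y t : L) (z : 'rV[L]_e.+2).
Local Notation scroll f := (scroll_model e e.*2.+1 f).

Lemma affine_zerosE f x y : size f = N ->
  (affine_pt e x y \in zeros (scroll f)) = (y ^+ 2 == f.[x]).
Proof. by move=> sf; rewrite affine_zeros ?sf. Qed.

Lemma scroll_zeros_proj_eq f z z' : proj_eq z z' ->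
  z \in zeros (scroll f) -> z' \in zeros (scroll f).
Proof.
case=> a an0 -> /scroll_zerosP[z0 z1 z2]; apply/scroll_zerosP; split.
- by rewrite scaler_eq0 negb_or an0.
- by rewrite crdZ exprMn z1 mulr_sumr; apply: eq_bigr => k _; rewrite !crdZ; ring.
by move=> i j ie je; rewrite !crdZ mulrACA z2 // mulrACA.
Qed.

Definition affine_action f (h : 'rV[L]_e.+2 -> 'rV[L]_e.+2) (m : rat_map L) :=
  mE m != 0 /\ forall x y, y ^+ 2 = f.[x] -> (mE m).[x] != 0 ->
    proj_eq (h (affine_pt e x y)) (affine_pt e (mX m x y) (mY m x y)).

Lemma morphism_affine_action f f1 h g : separable_poly f ->
  size f = N -> size f1 = N ->
  proj_morphism (scroll f) (scroll f1) h -> proj_morphism (scroll f1) (scroll f) g ->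
  (forall z, z \in zeros (scroll f1) -> proj_eq (h (g z)) z) ->
  exists m, affine_action f h m.
Proof.
move=> sepf sf sf1 hh hg hgK; have [hE hloc] := hh; have [gE _] := hg.
(* The base point is [g v] for an affine point [v] of the target which is not
   the image of a point at infinity; so both [g v] and its image are affine. *)
have [b bf] := closed_sqrt f`_e.*2.
pose r c := crd (h (infinite_pt e c)) 1 / crd (h (infinite_pt e c)) 0.
have [t] : exists t, (('X - (r b)%:P) * ('X - (r (- b))%:P)).[t] != 0.
  by apply: poly_nonroot; rewrite mulf_neq0 ?polyXsubC_eq0.
rewrite hornerM !hornerXsubC mulf_eq0 !subr_eq0 negb_or => /andP[tb tb'].
have [y1 y1E] := closed_sqrt f1.[t].
pose v := affine_pt e t y1.
have vE : v \in zeros (scroll f1) by rewrite affine_zerosE // y1E.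
have x0E := gE _ vE; set x0 := g v in x0E.
have hx0 : proj_eq (h x0) v by exact: hgK.
have x00 : crd x0 0 != 0.
  apply/eqP => x00; have [c cf x0c] := scroll_infinite e_gt0 x0E x00.
  have cE := infinite_zeros cf.
  have := proj_eq_trans (proj_eq_sym (proj_morphism_eq hh x0E cE x0c)) hx0.
  move/(proj_eq_ratio 1); rewrite !crd_affine // expr0 divr1 expr1 => tE.
  have : (c - b) * (c + b) = 0 by rewrite -subr_sqr cf bf subrr.
  move/eqP; rewrite mulf_eq0 subr_eq0 addr_eq0 => /orP[] /eqP cb; move: tE; rewrite cb => tE.
    by rewrite tE eqxx in tb.
  by rewrite tE eqxx in tb'.
have [d [P [hP]]] := hloc _ x0E; rewrite -/(mevals P x0) => Px0 Ploc.
have {}Ploc z : z \in zeros (scroll f) -> mevals P z != 0 -> proj_eq (h z) (mevals P z).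
  exact: Ploc.
have [[a0 b0] P0] := meval_affine f (P (inord 0)).
have [[a1 b1] P1] := meval_affine f (P (inord 1)).
have [[aY bY] PY] := meval_affine f (P (inord e.+1)).
have x0aff := scroll_affine x0E x00.
set xs := crd x0 1 / _ in x0aff; set ys := crd x0 e.+1 / _ in x0aff.
have lf : (1 < size f)%N by rewrite sf ltnS double_gt0.
(* The norm of the coordinate [a0 + b0 y]. If it were zero, that coordinate would vanish on the
   whole affine curve, contrary to the choice of [x0], whose image is affine. *)
have ab0 : a0 ^+ 2 - b0 ^+ 2 * f != 0.
  apply/eqP => /eqP; rewrite subr_eq0 => /eqP /(separable_nonsquare sepf lf)[a00 b00].
  have ysf : ys ^+ 2 = f.[xs].
    by apply/eqP; rewrite -affine_zerosE //; exact: scroll_zeros_proj_eq x0aff x0E.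
  have := P0 xs ys ysf; rewrite a00 b00 !horner0 mul0r addr0 => P00.
  have vP : proj_eq v (mevals P x0).
    exact: proj_eq_trans (proj_eq_sym hx0) (Ploc _ x0E Px0).
  have := proj_eq_crd0 vP; rewrite crd_affine // expr0 oner_eq0.
  rewrite /crd mxE => /negbT/negP; apply; case: x0aff P00 => a an0 ->.
  have -> : (P (inord 0)).@[(a *: x0) 0] = (P (inord 0)).@[fun i => a * x0 0 i].
    by apply: meval_eq => i; rewrite mxE.
  rewrite (meval_dhomog_scale _ _ (hP _)) => /eqP.
  by rewrite mulf_eq0 expf_eq0 (negPf an0) andbF.
(* Quotients of the coordinates of [P], with the denominator [a0 + b0 y] rationalized by its
   conjugate [a0 - b0 y]. *)
pose m := RatMap (a1 * a0 - b1 * b0 * f) (b1 * a0 - a1 * b0)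
  (aY * a0 - bY * b0 * f) (bY * a0 - aY * b0) (a0 ^+ 2 - b0 ^+ 2 * f).
exists m; split=> // x y yf Ex.
have ptE : affine_pt e x y \in zeros (scroll f) by rewrite affine_zerosE // yf.
have EE : (mE m).[x] = (a0.[x] + b0.[x] * y) * (a0.[x] - b0.[x] * y).
  by rewrite /= !horner_ringE -yf; ring.
move: (Ex); rewrite EE mulf_eq0 negb_or => /andP[D0 D1].
have c0 : crd (mevals P (affine_pt e x y)) 0 = a0.[x] + b0.[x] * y.
  by rewrite /crd mxE P0.
have c1 : crd (mevals P (affine_pt e x y)) 1 = a1.[x] + b1.[x] * y.
  by rewrite /crd mxE P1.
have cY : crd (mevals P (affine_pt e x y)) e.+1 = aY.[x] + bY.[x] * y.
  by rewrite /crd mxE PY.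
have Pn0 : mevals P (affine_pt e x y) != 0 by apply: (@crd_neq0 _ _ _ 0%N); rewrite c0.
have hP' := Ploc _ ptE Pn0.
have hc0 : crd (h (affine_pt e x y)) 0 != 0 by rewrite -(proj_eq_crd0 hP') c0.
have := scroll_affine (hE _ ptE) hc0.
rewrite -!(proj_eq_ratio _ hP') c0 c1 cY.
have -> : (a1.[x] + b1.[x] * y) / (a0.[x] + b0.[x] * y) = mX m x y.
  rewrite /mX /rat_xy EE /= !horner_ringE -yf.
  by move: D0 D1; clear; move=> D0 D1; field; rewrite D0 D1.
have -> // : (aY.[x] + bY.[x] * y) / (a0.[x] + b0.[x] * y) = mY m x y.
rewrite /mY /rat_xy EE /= !horner_ringE -yf.
by move: D0 D1; clear; move=> D0 D1; field; rewrite D0 D1.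
Qed.

Lemma affine_action_zeros f f1 h m : size f = N -> size f1 = N ->
  proj_morphism (scroll f) (scroll f1) h -> affine_action f h m ->
  forall x y, y ^+ 2 = f.[x] -> (mE m).[x] != 0 -> mY m x y ^+ 2 = f1.[mX m x y].
Proof.
move=> sf sf1 [hE _] [_ hm] x y yf Ex; apply/eqP; rewrite -affine_zerosE //.
apply: (scroll_zeros_proj_eq (hm x y yf Ex)); apply: hE.
by rewrite affine_zerosE // yf.
Qed.

(** For each [r] in [rs], at most two affine points of the target have first coordinate [r]; [g]
    brings them back to the values [c s] and [c (- s)] of [x], which become roots of [Z]. *)
Lemma affine_action_avoid f f1 h g m (rs : seq L) : size f = N -> size f1 = N ->
  proj_morphism (scroll f) (scroll f1) h -> proj_morphism (scroll f1) (scroll f) g ->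
  (forall z, z \in zeros (scroll f) -> proj_eq (g (h z)) z) ->
  affine_action f h m ->
  exists2 Z, Z != 0 & forall x y, y ^+ 2 = f.[x] -> (mE m).[x] != 0 ->
    mX m x y \in rs -> Z.[x] = 0.
Proof.
move=> sf sf1 hh hg ghK hm; elim: rs => [|r rs [Z Z0 HZ]].
  by exists 1; rewrite ?oner_neq0.
have [s sr] := closed_sqrt f1.[r].
pose c s := crd (g (affine_pt e r s)) 1 / crd (g (affine_pt e r s)) 0.
exists (Z * (('X - (c s)%:P) * ('X - (c (- s))%:P))).
  by rewrite !mulf_neq0 ?polyXsubC_eq0.
move=> x y yf Ex; rewrite inE => /predU1P[Xr|/(HZ x y yf Ex) Zx]; last first.
  by rewrite hornerM Zx mul0r.
have Y2 := affine_action_zeros sf sf1 hh hm yf Ex.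
have xE : x = c (mY m x y).
  have ptE : affine_pt e x y \in zeros (scroll f) by rewrite affine_zerosE // yf.
  have pt1E : affine_pt e (mX m x y) (mY m x y) \in zeros (scroll f1).
    by rewrite affine_zerosE // Y2.
  have hptE : h (affine_pt e x y) \in zeros (scroll f1) by case: hh => + _; exact.
  have := proj_eq_trans (proj_eq_sym (ghK _ ptE))
    (proj_morphism_eq hg hptE pt1E (hm.2 x y yf Ex)).
  move/(proj_eq_ratio 1); rewrite !crd_affine // expr0 divr1 expr1.
  by rewrite Xr -/(c (mY m x y)) => ->.
have : (mY m x y - s) * (mY m x y + s) = 0 by rewrite -subr_sqr Y2 Xr sr subrr.
move/eqP; rewrite mulf_eq0 subr_eq0 addr_eq0 => /orP[] /eqP Ys;
by rewrite !hornerM !hornerXsubC -{}Ys -xE subrr ?mul0r ?mulr0.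
Qed.

Lemma affine_action_inverse f f1 h g m m1 : size f = N -> size f1 = N ->
  proj_morphism (scroll f) (scroll f1) h -> proj_morphism (scroll f1) (scroll f) g ->
  (forall z, z \in zeros (scroll f) -> proj_eq (g (h z)) z) ->
  affine_action f h m -> affine_action f1 g m1 ->
  exists Z, rat_inverse f f1 m m1 Z.
Proof.
move=> sf sf1 hh hg ghK hm gm1.
(* With [rs] the roots of [mE m1], avoiding [rs] keeps [X] off the poles of the inverse map. *)
have [rs rsE] := closed_field_poly_normal (mE m1).
have [Z Z0 HZ] := affine_action_avoid rs sf sf1 hh hg ghK hm.
exists (mE m * Z); split; first by rewrite mulf_neq0 //; case: hm.
move=> x y yf; rewrite hornerM mulf_eq0 negb_or => /andP[Ex Zx].
have Y2 := affine_action_zeros sf sf1 hh hm yf Ex.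
have E1 : (mE m1).[mX m x y] != 0.
  apply: contraNneq Zx => E10; apply/eqP/(HZ x y yf Ex).
  have : root (mE m1) (mX m x y) by apply/rootP.
  rewrite {1}rsE rootZ ?lead_coef_eq0; last by case: gm1.
  by rewrite root_prod_XsubC.
have ptE : affine_pt e x y \in zeros (scroll f) by rewrite affine_zerosE // yf.
have pt1E : affine_pt e (mX m x y) (mY m x y) \in zeros (scroll f1).
  by rewrite affine_zerosE // Y2.
have hptE : h (affine_pt e x y) \in zeros (scroll f1) by case: hh => + _; exact.
have := proj_eq_trans (proj_eq_trans (proj_eq_sym (ghK _ ptE))
    (proj_morphism_eq hg hptE pt1E (hm.2 x y yf Ex))) (gm1.2 _ _ Y2 E1).
by case/(affine_proj_inj e_gt0) => <- <-.
Qed.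

Theorem scroll_isomorphic_dichotomy f f1 : separable_poly f -> separable_poly f1 ->
  size f = N -> size f1 = N -> proj_isomorphic (scroll f) (scroll f1) ->
  (e = 2%N /\ polyI f ^+ 3 * polyD f1 = polyI f1 ^+ 3 * polyD f) \/ moebius_roots f f1.
Proof.
move=> sepf sepf1 sf sf1 [h [g [hh hg ghK hgK]]].
have [m hm] := morphism_affine_action sepf sf sf1 hh hg hgK.
have [m1 gm1] := morphism_affine_action sepf1 sf1 sf hg hh ghK.
have [Z inv] := affine_action_inverse sf sf1 hh hg ghK hm gm1.
have [Z1 inv1] := affine_action_inverse sf1 sf hg hh hgK gm1 hm.
have E0 := hm.1; have E10 := gm1.1.
have [B0|B0] := eqVneq (mB m) 0; last first.
  by left; have [] := biquadratic_case two_neq0 sepf sepf1 sf sf1 e_ge2 E0 E10 inv inv1 B0.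
(* Here [biquadratic_case] for the inverse isomorphism would give [mB m != 0]. *)
have [B10|B10] := eqVneq (mB m1) 0; last first.
  have [] := biquadratic_case two_neq0 sepf1 sepf sf1 sf e_ge2 E10 E0 inv1 inv B10.
  by rewrite B0 eqxx.
by right; exact: (moebius_case two_neq0 sepf sf sf1 e_ge2 E0 E10 B0 B10 inv).
Qed.
End ScrollIsomorphism.

(** * Smoothness *)

(** Smoothness is read off from the kernel of the Jacobian, spanned by the point itself and one
    tangent direction, so that no minor has to be chosen. *)
Lemma mxrank_ker_plane (F : fieldType) k n (J : 'M[F]_(k, n)) (u v : 'rV[F]_n) :
  (forall w : 'rV_n, w *m J^T = 0 <-> exists a b, w = a *: u + b *: v) ->
  (forall a b, a *: u + b *: v = 0 -> a = 0 /\ b = 0) ->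
  (\rank J + 2 = n)%N.
Proof.
move=> kerJ uv_free.
have mulE (w : 'rV_(1 + 1)) : w *m col_mx u v = lsubmx w 0 0 *: u + rsubmx w 0 0 *: v.
  rewrite -{1}[w]hsubmxK mul_row_col [lsubmx w]mx11_scalar [rsubmx w]mx11_scalar.
  by rewrite !mul_scalar_mx !mxE !eqxx !mulr1n.
have rk2 : \rank (col_mx u v) = 2%N.
  apply/eqP; rewrite -[_ == _]/(row_free (col_mx u v)) -kermx_eq0.
  apply/rowV0P => w /sub_kermxP; rewrite mulE => /uv_free[w0 w1].
  rewrite -[w]hsubmxK [lsubmx w]mx11_scalar [rsubmx w]mx11_scalar w0 w1.
  by rewrite !raddf0 row_mx0.
have kerE : (kermx J^T :=: col_mx u v)%MS.
  apply/eqmxP/andP; split.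
    apply/row_subP => i; have : row i (kermx J^T) *m J^T = 0.
      by apply/sub_kermxP; exact: row_sub.
    move/kerJ => [a [b ->]].
    rewrite (_ : _ + _ = row_mx a%:M b%:M *m col_mx u v) ?submxMl //.
    by rewrite mul_row_col !mul_scalar_mx.
  rewrite col_mx_sub; apply/andP; split; apply/sub_kermxP/kerJ.
    by exists 1, 0; rewrite scale1r scale0r addr0.
  by exists 0, 1; rewrite scale1r scale0r add0r.
by move: rk2; rewrite -kerE mxrank_ker mxrank_tr; clear; lia.
Qed.

Section Smooth.
Variables (L : closedFieldType) (e : nat).
Hypothesis two_neq0 : (2%:R : L) != 0.
Hypothesis e_gt0 : (0 < e)%N.
Let N := e.*2.+1.
Implicit Types (f : {poly L}) (x y t : L) (z w : 'rV[L]_e.+2).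
Local Notation scroll f := (scroll_model e e.*2.+1 f).

Definition dir_deriv (q : {mpoly L[e.+2]}) z w := \sum_j q^`M(j).@[z 0] * w 0 j.

Lemma dir_derivD z w : {morph (fun q => dir_deriv q z w) : p q / p + q}.
Proof.
move=> p q; rewrite /dir_deriv -big_split; apply: eq_bigr => j _ /=.
by rewrite mderivD mevalD mulrDl.
Qed.

Lemma dir_derivZ c q z w : dir_deriv (c *: q) z w = c * dir_deriv q z w.
Proof.
rewrite /dir_deriv mulr_sumr; apply: eq_bigr => j _.
by rewrite mderivZ mevalZ mulrA.
Qed.

Lemma dir_derivM p q z w :
  dir_deriv (p * q) z w = dir_deriv p z w * q.@[z 0] + p.@[z 0] * dir_deriv q z w.
Proof.
rewrite /dir_deriv mulr_suml mulr_sumr -big_split; apply: eq_bigr => j _ /=.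
by rewrite mderivM mevalD !mevalM mulrDl mulrAC mulrA.
Qed.

Lemma dir_deriv_sum n (F : 'I_n -> {mpoly L[e.+2]}) z w :
  dir_deriv (\sum_k F k) z w = \sum_k dir_deriv (F k) z w.
Proof.
apply: (big_morph (fun q => dir_deriv q z w) (dir_derivD z w)).
by rewrite -(scale0r (0 : {mpoly L[e.+2]})) dir_derivZ mul0r.
Qed.

Lemma dir_derivB p q z w : dir_deriv (p - q) z w = dir_deriv p z w - dir_deriv q z w.
Proof. by rewrite dir_derivD -scaleN1r dir_derivZ mulN1r. Qed.

Lemma dir_derivX i z w : dir_deriv 'X_i z w = w 0 i.
Proof.
rewrite /dir_deriv (bigD1 i) //= big1 => [|j ji].
  rewrite mderivX mnm1E eqxx scale1r addr0.
  have -> : (U_(i) - U_(i))%MM = 0%MM by apply/mnmP => k; rewrite mnmBE mnm0E subnn.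
  by rewrite mpolyX0 meval1 mul1r.
by rewrite mderivX mnm1E eq_sym (negPf ji) scale0r meval0 mul0r.
Qed.

Definition tangent f z w :=
  (crd z e.+1 * crd w e.+1 *+ 2 = \sum_(k < N) f`_k *
     (crd w k./2 * crd z (uphalf k) + crd z k./2 * crd w (uphalf k))) /\
  forall i j, (i < e)%N -> (j < e)%N ->
    crd w i * crd z j.+1 + crd z i * crd w j.+1
    = crd w i.+1 * crd z j + crd z i.+1 * crd w j.

Lemma jacobian_kernel f z w :
  w *m (jacobian (scroll f) z)^T = 0 <-> tangent f z w.
Proof.
have dE : (w *m (jacobian (scroll f) z)^T = 0) <->
    (forall q, q \in scroll f -> dir_deriv q z w = 0).
  split=> [H q qE|H].
    have iq : (index q (scroll f) < size (scroll f))%N by rewrite index_mem.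
    have /rowP/(_ (Ordinal iq)) := H; rewrite !mxE => <-.
    by apply: eq_bigr => j _; rewrite !mxE nth_index // mulrC.
  apply/rowP => i; rewrite !mxE -[RHS](H ((scroll f)`_i)); last exact: mem_nth.
  by apply: eq_bigr => j _; rewrite !mxE mulrC.
have d0 : dir_deriv ('X_(inord e.+1) ^+ 2
      - \sum_(k < N) f`_k *: ('X_(inord k./2) * 'X_(inord (uphalf k)))) z w
   = crd z e.+1 * crd w e.+1 *+ 2 - \sum_(k < N) f`_k *
     (crd w k./2 * crd z (uphalf k) + crd z k./2 * crd w (uphalf k)).
  rewrite dir_derivB expr2 dir_derivM !dir_derivX mevalXU dir_deriv_sum.
  congr (_ - _); first by rewrite /crd mulrC mulr2n.
  by apply: eq_bigr => k _; rewrite dir_derivZ dir_derivM !dir_derivX !mevalXU.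
have d1 i j : dir_deriv ('X_(inord i) * 'X_(inord j.+1) - 'X_(inord i.+1) * 'X_(inord j)) z w
   = crd w i * crd z j.+1 + crd z i * crd w j.+1
    - (crd w i.+1 * crd z j + crd z i.+1 * crd w j).
  by rewrite dir_derivB !dir_derivM !dir_derivX !mevalXU.
rewrite dE; split=> [H|[H0 H1] q].
  split; first by apply/eqP; rewrite -subr_eq0 -d0 H ?mem_head.
  move=> i j ie je; apply/eqP; rewrite -subr_eq0 -d1 H //.
  rewrite inE; apply/orP; right.
  by apply/allpairsP; exists (i, j); rewrite !mem_iota.
rewrite inE => /predU1P[->|]; first by rewrite d0 H0 subrr.
by case/allpairsP=> -[i j] /=; rewrite !mem_iota /= => -[ie je ->]; rewrite d1 H1 // subrr.
Qed.

Lemma tangent_scale f a z w : a != 0 -> tangent f (a *: z) w <-> tangent f z w.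
Proof.
move=> a0; rewrite /tangent.
have -> : \sum_(k < N) f`_k * (crd w k./2 * crd (a *: z) (uphalf k) + crd (a *: z) k./2 * crd w (uphalf k))
  = a * \sum_(k < N) f`_k * (crd w k./2 * crd z (uphalf k) + crd z k./2 * crd w (uphalf k)).
  by rewrite mulr_sumr; apply: eq_bigr => k _; rewrite !crdZ; ring.
rewrite crdZ -mulrA -mulrnAr; split=> -[H0 H1]; split.
- exact: (mulfI a0).
- move=> i j ie je; apply: (mulfI a0); have := H1 i j ie je; rewrite !crdZ => H.
  transitivity (crd w i * (a * crd z j.+1) + a * crd z i * crd w j.+1); first by ring.
  by rewrite H; ring.
- by rewrite H0.
move=> i j ie je; rewrite !crdZ.
transitivity (a * (crd w i * crd z j.+1 + crd z i * crd w j.+1)); first by ring.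
by rewrite H1 //; ring.
Qed.

Lemma crdD z w i : crd (z + w) i = crd z i + crd w i.
Proof. by rewrite /crd mxE. Qed.

Section AffineTangent.
Variables (f : {poly L}) (t y : L).
Hypothesis (sf : size f = N) (yf : y ^+ 2 = f.[t]).
(* The derivative of [t ^+ j]. *)
Let D j := t ^+ j.-1 *+ j.

(** Leibniz rule for [t ^+ i * t ^+ j]. *)
Lemma dpowD i j : D i * t ^+ j + t ^+ i * D j = D (i + j)%N.
Proof.
rewrite /D; case: i => [|i]; first by rewrite mulr0n mul0r add0r mul1r.
case: j => [|j]; first by rewrite mulr0n mulr0 addr0 mulr1 addn0.
by rewrite /= !mulrnAl !mulrnAr -!exprD addSnnS -mulrnDr addSnnS.
Qed.

Lemma dpowS j : D j.+1 = t ^+ j + t * D j.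
Proof. by rewrite -add1n -dpowD /D mulr1n expr0 mul1r expr1. Qed.

Lemma sum_dpow : \sum_(k < N) f`_k * D k = f^`().[t].
Proof.
rewrite -{2}[f]coefK poly_def sf raddf_sum /= horner_sum; apply: eq_bigr => k _.
by rewrite derivZ derivXn hornerZ hornerMn hornerXn.
Qed.

(* The velocity of [(t, y)] along [y ^+ 2 = f.[t]] at speed [dt = 2 y], which is
   nonzero also at the points with [y = 0]. *)
Definition affine_tangent : 'rV[L]_e.+2 :=
  \row_j (if (j <= e)%N then y * D j *+ 2 else f^`().[t]).

Lemma crd_tangent i : (i <= e)%N -> crd affine_tangent i = y * D i *+ 2.
Proof. by move=> ie; rewrite /crd mxE inordK ?ie // ltnS ltnW. Qed.

Lemma crd_tangentY : crd affine_tangent e.+1 = f^`().[t].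
Proof. by rewrite /crd mxE inordK // ltnn. Qed.

(** The linearized minors force the coordinates of [w] up to [X_e] to be [a t^j + d D_j]. The
    remaining equation [2 y (w_Y - a y) = d f'(t)] makes [(d, w_Y - a y)] a multiple of
    [(2 y, f'(t))], because [y] and [f'(t)] do not vanish together when [f] is separable. *)
Lemma tangent_affine w : separable_poly f ->
  tangent f (affine_pt e t y) w <->
  exists a b, w = a *: affine_pt e t y + b *: affine_tangent.
Proof.
move=> sepf; set p := affine_pt e t y.
have sumE a d : (forall j, (j <= e)%N -> crd w j = a * t ^+ j + d * D j) ->
    \sum_(k < N) f`_k * (crd w k./2 * crd p (uphalf k) + crd p k./2 * crd w (uphalf k))
    = a * y ^+ 2 *+ 2 + d * f^`().[t].
  move=> wE; rewrite yf (horner_coef_wide _ (_ : size f <= N)%N) ?sf // -sum_dpow.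
  rewrite mulr_sumr -sumrMnl mulr_sumr -big_split; apply: eq_bigr => k _ /=.
  have kN : (uphalf k <= e)%N by have := ltn_ord k; rewrite /N; lia.
  have kN' : (k./2 <= e)%N by have := ltn_ord k; rewrite /N; lia.
  have Dk : D k = D k./2 * t ^+ uphalf k + t ^+ k./2 * D (uphalf k).
    by rewrite dpowD half_uphalf.
  have tk : t ^+ k = t ^+ k./2 * t ^+ uphalf k by rewrite -exprD half_uphalf.
  by rewrite !wE // !crd_affine // Dk tk; ring.
split=> [[H0 H1]|[a [b wE]]].
  pose a := crd w 0; pose d := crd w 1 - t * a.
  have wE j : (j <= e)%N -> crd w j = a * t ^+ j + d * D j.
    elim: j => [|j IH] je; first by rewrite /D mulr0n mulr0 addr0 mulr1.
    have := H1 0%N j (leq_ltn_trans (leq0n j) je) je.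
    rewrite !crd_affine ?(ltnW je) // expr0 expr1 mul1r => /(canRL (addKr _)) ->.
    by rewrite IH ?(ltnW je) // -/a dpowS /d exprS; ring.
  have {}H0 : y * (crd w e.+1 - a * y) *+ 2 = d * f^`().[t].
    move: H0; rewrite (sumE a d wE) crd_affineY => H0.
    by rewrite mulrBr mulrnBl H0; ring.
  have [la [dE lE]] : exists la, d = la * y *+ 2 /\ crd w e.+1 - a * y = la * f^`().[t].
    have [y0|y0] := eqVneq y 0.
      have ft : f^`().[t] != 0.
        have ft0 : root f t by rewrite rootE -yf y0 expr0n.
        have : ~~ root f^`() t.
          by apply: (@coprimep_root _ _ _ _ _ ft0); move: sepf; rewrite unlock.
        by rewrite rootE.
      exists ((crd w e.+1 - a * y) / f^`().[t]); rewrite divfK //; split=> //.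
      rewrite y0 mulr0 mul0rn; move/eqP: H0.
      by rewrite y0 mul0r mul0rn eq_sym mulf_eq0 (negPf ft) orbF => /eqP.
    exists (d / (y * 2%:R)); split; first by field; rewrite y0 two_neq0.
    rewrite mulrAC -H0; field; by rewrite y0 two_neq0.
  exists a, la; apply: crdP => [i ie|]; rewrite crdD !crdZ.
    by rewrite wE // dE crd_affine // crd_tangent //; ring.
  by rewrite crd_affineY crd_tangentY -lE; ring.
have wj j : (j <= e)%N -> crd w j = a * t ^+ j + (b * y *+ 2) * D j.
  by move=> je; rewrite wE crdD !crdZ crd_affine // crd_tangent //; ring.
split.
  rewrite (sumE _ _ wj) wE crdD !crdZ crd_affineY crd_tangentY; ring.
move=> i j ie je; rewrite !wj ?(ltnW ie) ?(ltnW je) // !crd_affine ?(ltnW ie) ?(ltnW je) //.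
set c := b * y *+ 2.
have H : D i * t ^+ j.+1 + t ^+ i * D j.+1 = D i.+1 * t ^+ j + t ^+ i.+1 * D j.
  by rewrite !dpowD addSnnS.
transitivity (a * (t ^+ i * t ^+ j.+1) *+ 2 + c * (D i * t ^+ j.+1 + t ^+ i * D j.+1)).
  by ring.
by rewrite H !exprS; ring.
Qed.
End AffineTangent.

(** In the chart [X_e = 1] with [u = X_(e-1)] the curve is [Y^2 = f_(2e) + f_(2e-1) u + ...], whose
    tangent direction at [(0, b)] is [(2 b, f_(2e-1))]. *)
Definition infinite_tangent f b : 'rV[L]_e.+2 :=
  \row_j (if j == e.-1 :> nat then b *+ 2 else
           if j == e.+1 :> nat then f`_e.*2.-1 else 0).

Lemma crd_inf_tangent f b i : (i < e.-1)%N -> crd (infinite_tangent f b) i = 0.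
Proof.
move=> ie; rewrite /crd mxE inordK; last by move: ie; lia.
by rewrite !ltn_eqF //; move: ie; lia.
Qed.

Lemma crd_inf_tangentP f b : crd (infinite_tangent f b) e.-1 = b *+ 2.
Proof. by rewrite /crd mxE inordK ?eqxx //; lia. Qed.

Lemma crd_inf_tangentX f b : crd (infinite_tangent f b) e = 0.
Proof.
rewrite /crd mxE inordK // (gtn_eqF (_ : e.-1 < e)%N) ?prednK //.
by rewrite (ltn_eqF (ltnSn e)).
Qed.

Lemma crd_inf_tangentY f b : crd (infinite_tangent f b) e.+1 = f`_e.*2.-1.
Proof.
by rewrite /crd mxE inordK // eqxx gtn_eqF // ltnS leq_pred.
Qed.

Lemma tangent_infinite f b w : size f = N -> b ^+ 2 = f`_e.*2 ->
  tangent f (infinite_pt e b) w <->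
  exists u v, w = u *: infinite_pt e b + v *: infinite_tangent f b.
Proof.
move=> sf bf; set p := infinite_pt e b.
have b0 : b != 0.
  have : lead_coef f != 0 by rewrite lead_coef_eq0 -size_poly_gt0 sf.
  by rewrite lead_coefE sf -bf expf_eq0.
have e1 : e.-1.+1 = e by rewrite prednK.
have sumE : \sum_(k < N) f`_k * (crd w k./2 * crd p (uphalf k) + crd p k./2 * crd w (uphalf k))
    = f`_e.*2 * crd w e *+ 2 + f`_e.*2.-1 * crd w e.-1.
  pose G k := f`_k * (crd w k./2 * crd p (uphalf k) + crd p k./2 * crd w (uphalf k)).
  have NE : N = e.-1.*2.+3 by rewrite /N -{1}e1.
  rewrite -(big_mkord xpredT G) NE big_mkord /G !big_ord_recr /= big1 => [|k _]; last first.
    rewrite (crd_inf b (_ : uphalf k < e)%N) ?(crd_inf b (_ : k./2 < e)%N) ?mulr0 ?mul0r ?addr0 ?mulr0 //;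
    by have := ltn_ord k; lia.
  have i2 : e.-1.*2.+2 = e.*2 by rewrite -{2}e1.
  have i1 : e.-1.*2.+1 = e.*2.-1 by rewrite -{2}e1.
  rewrite add0r uphalf_double doubleK i2 i1 e1.
  rewrite /p crd_infX (crd_inf b (_ : e.-1 < e)%N); last by rewrite -{2}e1.
  by ring.
split=> [[H0 H1]|[u [v wE]]].
  have wi i : (i < e.-1)%N -> crd w i = 0.
    move=> ie; have ie' : (i.+1 < e)%N by rewrite -e1.
    have le1 : (e.-1 < e)%N by rewrite -{2}e1.
    have := H1 i e.-1 (ltnW ie') le1; rewrite e1 crd_infX mulr1.
    by rewrite (crd_inf b (ltnW ie')) (crd_inf b ie') (crd_inf b le1) !mulr0 !mul0r !addr0.
  exists (crd w e), (crd w e.-1 / (b *+ 2)).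
  have b20 : b *+ 2 != 0 by rewrite -mulr_natr mulf_neq0.
  apply: crdP => [i|]; rewrite crdD !crdZ.
    rewrite leq_eqVlt => /predU1P[->|]; first by rewrite crd_infX crd_inf_tangentX mulr0 addr0 mulr1.
    rewrite -{1}e1 ltnS leq_eqVlt => /predU1P[->|ie].
      by rewrite crd_inf_tangentP divfK // crd_inf ?mulr0 ?add0r // -{2}e1.
    by rewrite wi // crd_inf_tangent // crd_inf ?mulr0 ?addr0 // -e1 ltnW.
  move: H0; rewrite sumE crd_infY crd_inf_tangentY -bf => H0.
  apply: (mulfI b20); rewrite [LHS]mulrnAl H0.
  by field; rewrite b0 two_neq0.
have wi i : (i < e.-1)%N -> crd w i = 0.
  by move=> ie; rewrite wE crdD !crdZ crd_inf_tangent // crd_inf ?mulr0 ?addr0 // -e1 ltnW.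
split.
  rewrite sumE wE !crdD !crdZ crd_infY crd_infX crd_inf_tangentX crd_inf_tangentY.
  rewrite crd_inf_tangentP (crd_inf b (_ : e.-1 < e)%N); last by rewrite -{2}e1.
  by rewrite -bf; ring.
move=> i j ie je; rewrite (crd_inf b ie) (crd_inf b je) mul0r mulr0 addr0 add0r.
have small k : (k < e)%N -> k = e.-1 \/ (k < e.-1)%N.
  by rewrite -{1}e1 ltnS leq_eqVlt => /predU1P.
have px k : (k < e.-1)%N -> crd p k.+1 = 0 by move=> ke; rewrite crd_inf // -e1.
case: (small _ ie) (small _ je) => [->|ie'] [->|je'].
- by rewrite mulrC.
- by rewrite (px _ je') (wi _ je') !mulr0.
- by rewrite (px _ ie') (wi _ ie') !mul0r.
- by rewrite (wi _ ie') (wi _ je') mul0r mulr0.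
Qed.

Theorem scroll_smooth f : separable_poly f -> size f = N -> proj_smooth (scroll f).
Proof.
move=> sepf sf z zE; apply/eqP; rewrite -eqSS; apply/eqP.
have smooth_at a p v : a != 0 -> z = a *: p ->
    (forall w, tangent f p w <-> exists b c, w = b *: p + c *: v) ->
    (forall b c, b *: p + c *: v = 0 -> b = 0 /\ c = 0) ->
    (\rank (jacobian (scroll f) z)).+2 = e.+2.
  move=> a0 zp tp free; rewrite -addn2.
  apply: (mxrank_ker_plane (u := p) (v := v)) free => w.
  by rewrite jacobian_kernel zp tangent_scale.
have [z0|z0] := eqVneq (crd z 0) 0.
  have [b bf zb] := scroll_infinite e_gt0 zE z0.
  have [a a0 za] := proj_eq_sym zb.
  apply: (smooth_at _ _ _ a0 za (fun w => tangent_infinite w sf bf)) => c d H.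
  have b20 : b *+ 2 != 0.
    have : lead_coef f != 0 by rewrite lead_coef_eq0 -size_poly_gt0 sf.
    rewrite lead_coefE sf -bf expf_eq0 /= => b0.
    by rewrite -mulr_natr mulf_neq0.
  have := congr1 (fun u => crd u e) H; have := congr1 (fun u => crd u e.-1) H.
  rewrite /= !crdD !crdZ crd_infX crd_inf_tangentX crd_inf_tangentP.
  rewrite crd_inf ?prednK // /crd !mxE mulr1 !mulr0 add0r addr0 => /eqP.
  by rewrite mulf_eq0 (negPf b20) orbF => /eqP.
have zt := scroll_affine zE z0.
have [a a0 za] := proj_eq_sym zt.
move: (crd z 1 / crd z 0) (crd z e.+1 / crd z 0) za zt => t y za zt.
have yf : y ^+ 2 = f.[t].
  apply/eqP; rewrite -(affine_zeros _ _ (_ : size f <= N)%N (leqnn _)) ?sf //.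
  exact: scroll_zeros_proj_eq zt zE.
apply: (smooth_at _ _ _ a0 za (fun w => tangent_affine sf yf w sepf)) => c d H.
have := congr1 (fun u => crd u 0) H; have := congr1 (fun u => crd u 1) H.
have := congr1 (fun u => crd u e.+1) H.
rewrite /= !crdD !crdZ crd_affineY crd_tangentY !crd_affine // !crd_tangent //.
rewrite !expr0 !expr1 mulr1 mulr0n mulr0 mul0rn mulr0 addr0 /crd !mxE => H3 H2 c0.
split=> //; move: H3 H2; rewrite c0 !mul0r !add0r mulr1n mulr1 => /eqP.
rewrite mulf_eq0 => /orP[/eqP //|/eqP ft] /eqP.
rewrite -mulr_natr !mulf_eq0 (negPf two_neq0) orbF => /orP[/eqP //|/eqP y0].
have : coprimep f f^`() by move: sepf; rewrite unlock.
move/coprimep_root => /(_ t); rewrite !rootE -yf y0 expr0n eqxx ft => /(_ isT).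
by rewrite eqxx.
Qed.
End Smooth.

(** * Elements algebraic over the prime field *)

(** The orbit stays in the finite [S], so it repeats; injectivity cancels the steps before the
    cycle. *)
Lemma iter_inj_periodic (T : eqType) (s : T -> T) (S : seq T) x : injective s ->
  (forall y, y \in S -> s y \in S) -> x \in S -> exists n, iter n.+1 s x = x.
Proof.
move=> sI sS xS; have trS n : {subset traject s x n <= S}.
  move=> y /trajectP[i _ ->]; elim: i => //= i; exact: sS.
have : ~~ uniq (traject s x (size S).+1).
  by apply/negP => /uniq_leq_size /(_ (trS _)); rewrite size_traject ltnn.
rewrite looping_uniq negbK /looping => /trajectP[i iS].
have iterI : injective (iter i s) by elim: {iS} i => //= i IH y z /sI /IH.
rewrite -(subnKC (ltnW iS)) iterD => /iterI H.
by exists (size S - i).-1; rewrite prednK // subn_gt0.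
Qed.

Section Periodic.
Variables (L : closedFieldType) (p : nat).
Hypothesis charLp : p \in [pchar L].
Let p_prime : prime p := pcharf_prime charLp.

Lemma frobenius_power n : exists s : {rmorphism L -> L}, forall z, s z = z ^+ (p ^ n).
Proof.
elim: n => [|n [s sE]]; first by exists idfun => z; rewrite expn0 expr1.
exists (pFrobenius_aut charLp \o s) => z /=.
by rewrite pFrobenius_autE sE -exprM expnSr.
Qed.

(** Membership in the algebraic closure of [F_p], by [in_FpbarP], phrased so that closure under the
    field operations is immediate: a power of Frobenius is a ring morphism. *)
Definition periodic (z : L) := exists n, z ^+ (p ^ n.+1) = z.

Lemma frobenius_iter n k (z : L) : iter k (fun w : L => w ^+ (p ^ n)) z = z ^+ (p ^ (n * k)).
Proof.
elim: k => [|k IH]; first by rewrite muln0 expn0 expr1.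
by rewrite iterS IH -exprM -expnD mulnS addnC.
Qed.

Lemma frobenius_fixedM n k (z : L) : z ^+ (p ^ n) = z -> z ^+ (p ^ (n * k)) = z.
Proof. by move=> zn; rewrite -frobenius_iter; elim: k => //= k ->. Qed.

Lemma periodic_seq (S : seq L) : (forall z, z \in S -> periodic z) ->
  exists n, forall z, z \in S -> z ^+ (p ^ n.+1) = z.
Proof.
elim: S => [|x S IH] H; first by exists 0%N.
have [n nS] : exists n, forall z, z \in S -> z ^+ (p ^ n.+1) = z.
  by apply: IH => z zS; apply: H; rewrite inE zS orbT.
have [k kx] := H x (mem_head _ _).
have E : (n.+1 * k.+1 = (n.+1 * k.+1).-1.+1)%N by [].
exists (n.+1 * k.+1).-1 => z; rewrite -E inE => /predU1P[->|/nS zn].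
  by rewrite mulnC; exact: frobenius_fixedM.
exact: frobenius_fixedM.
Qed.

Lemma periodic2 x y : periodic x -> periodic y ->
  exists s : {rmorphism L -> L}, [/\ s x = x, s y = y & forall z, s z = z -> periodic z].
Proof.
move=> px py; have [|n nS] := @periodic_seq [:: x; y].
  by move=> z; rewrite !inE => /orP[]/eqP ->.
have [s sE] := frobenius_power n.+1.
exists s; rewrite !sE !nS ?mem_head ?inE ?eqxx ?orbT //; split=> // z.
by rewrite sE => zE; exists n.
Qed.

Lemma periodicD x y : periodic x -> periodic y -> periodic (x + y).
Proof. by move=> px py; have [s [sx sy]] := periodic2 px py; apply; rewrite rmorphD sx sy. Qed.

Lemma periodicM x y : periodic x -> periodic y -> periodic (x * y).
Proof. by move=> px py; have [s [sx sy]] := periodic2 px py; apply; rewrite rmorphM sx sy. Qed.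

Lemma periodicN x : periodic x -> periodic (- x).
Proof. by move=> px; have [s [sx _]] := periodic2 px px; apply; rewrite rmorphN sx. Qed.

Lemma periodicB x y : periodic x -> periodic y -> periodic (x - y).
Proof. by move=> px /periodicN; exact: periodicD. Qed.

Lemma periodicV x : periodic x -> periodic x^-1.
Proof. by move=> px; have [s [sx _]] := periodic2 px px; apply; rewrite fmorphV sx. Qed.

Lemma periodic_nat n : periodic n%:R.
Proof. by have [s sE] := frobenius_power 1; exists 0%N; rewrite -sE rmorph_nat. Qed.

Lemma periodic_seq_stable n (S : seq L) z :
  (forall w, w \in S -> w ^+ (p ^ n.+1) \in S) -> z \in S -> periodic z.
Proof.
move=> HS zS; have [s sE] := frobenius_power n.+1.
have sI : injective (fun w : L => w ^+ (p ^ n.+1)).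
  by move=> x y /=; rewrite -!sE => /fmorph_inj.
have [k] := iter_inj_periodic sI HS zS.
rewrite frobenius_iter => zE.
by exists (n.+1 * k.+1).-1.
Qed.

(** The power of Frobenius that fixes the coefficients maps the finite set of roots of [P] to
    itself. *)
Lemma periodic_root n (P : {poly L}) z : P != 0 ->
  (forall i, P`_i ^+ (p ^ n.+1) = P`_i) -> root P z -> periodic z.
Proof.
move=> P0 Pn Pz; have [rs rsE] := closed_field_poly_normal P.
have rsP w : (w \in rs) = root P w.
  by rewrite rsE rootZ ?lead_coef_eq0 // root_prod_XsubC.
apply: (@periodic_seq_stable n rs); last by rewrite rsP.
move=> w; rewrite !rsP => Pw; have [s sE] := frobenius_power n.+1.
have PE : map_poly s P = P by apply/polyP => i; rewrite coef_map /= sE Pn.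
by rewrite -sE -PE; exact: rmorph_root.
Qed.

Lemma periodic_sqrt z : periodic (z ^+ 2) -> periodic z.
Proof.
move=> [n zn]; apply: (@periodic_root n ('X^2 - (z ^+ 2)%:P)).
- by rewrite -size_poly_eq0 size_XnsubC.
- have [s sE] := frobenius_power n.+1.
  move=> i; rewrite -sE coefB coefXn coefC rmorphB rmorph_nat.
  by case: ifP => _; rewrite ?rmorph0 // sE zn.
by rewrite rootE !hornerE subrr.
Qed.

Lemma in_FpbarP z : in_Fpbar p z <-> periodic z.
Proof.
have frob_nat n i : (i%:R : L) ^+ (p ^ n) = i%:R.
  by have [s sE] := frobenius_power n; rewrite -sE rmorph_nat.
split=> [[q q0 qz]|[n zn]].
  apply: (@periodic_root 0%N _ _ _ _ qz).
    apply: contraNneq q0 => /polyP q0; apply/eqP/polyP => i; rewrite coef0.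
    have := q0 i; rewrite coef_map_id0 // coef0 => /eqP.
    rewrite -(dvdn_pcharf charLp) => qi; apply/val_inj => /=.
    have := ltn_ord q`_i; rewrite [X in (_ < X)%N]Fp_cast // => lt.
    by move: qi; apply: contraTeq => qi; rewrite gtnNdvd // lt0n.
  by move=> i; rewrite coef_map_id0 // frob_nat.
have fE k : (nat_of_ord (k%:R : 'F_p))%:R = k%:R :> L.
  rewrite [nat_of_ord _](val_Fp_nat p_prime) {2}(divn_eq k p) natrD natrM.
  by rewrite (pcharf0 charLp) mulr0 add0r.
have p1E : (p.-1)%:R = -1 :> L.
  by apply/eqP; rewrite -subr_eq0 opprK natr1 prednK ?prime_gt0 // (pcharf0 charLp).
have pn1 : (1 < p ^ n.+1)%N by rewrite -{1}(expn0 p) ltn_exp2l // prime_gt1.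
(* The preimage of [X^(p^(n+1)) - X]: the coefficient [-1] is entered as [p.-1] because the
   coefficient map goes through representatives in [nat]. *)
exists ('X^(p ^ n.+1) + (p.-1)%:R *: 'X).
  apply: contraTneq isT => /(congr1 (fun q : {poly 'F_p} => q`_(p ^ n.+1))).
  rewrite coefD coefXn coefZ coefX eqxx (gtn_eqF pn1) mulr0 addr0 coef0.
  by move/eqP; rewrite oner_eq0.
have -> : map_poly (fun a : 'F_p => (nat_of_ord a)%:R) ('X^(p ^ n.+1) + (p.-1)%:R *: 'X)
    = 'X^(p ^ n.+1) - 'X :> {poly L}.
  apply/polyP => i; rewrite coef_map_id0 // coefB !coefD coefZ !coefXn !coefX.
  by rewrite -natrM -natrD fE natrD natrM p1E mulN1r.
by rewrite rootE hornerD hornerN hornerXn hornerX zn subrr.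
Qed.

(** [L] contains the [p ^ n]-th roots of its elements. *)
Lemma frobenius_inverse n (s : {rmorphism L -> L}) :
  (forall z, s z = z ^+ (p ^ n)) -> exists2 t : L -> L, cancel s t & cancel t s.
Proof.
move=> sE; have s_surj w : exists v, s v == w.
  have pn0 : (0 < p ^ n)%N by rewrite expn_gt0 prime_gt0.
  have [v] := @solve_monicpoly L _ (fun i => if i == 0%N then w else 0) pn0.
  rewrite (bigD1 (Ordinal pn0)) //= expr0 mulr1 big1 ?addr0 => [|i].
    by rewrite -sE => <-; exists v.
  by rewrite -val_eqE /= => /negPf ->; rewrite mul0r.
have tK w : s (xchoose (s_surj w)) = w by apply/eqP; exact: (xchooseP (s_surj w)).
by exists (fun w => xchoose (s_surj w)) => // z; apply: (fmorph_inj s).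
Qed.

(** * Cross-ratios of roots and their behaviour under Frobenius *)

Definition cross_ratio (r1 r2 r3 r4 : L) : L :=
  ((r1 - r3) * (r2 - r4)) / ((r1 - r4) * (r2 - r3)).

(** A Moebius map multiplies [r - r'] by [D / ((c r + d) (c r' + d))], so numerator and denominator
    gain the same factor [k]; this covers coinciding arguments as well. *)
Lemma cross_ratio_moebius (a b c d r1 r2 r3 r4 : L) : a * d - b * c != 0 ->
  c * r1 + d != 0 -> c * r2 + d != 0 -> c * r3 + d != 0 -> c * r4 + d != 0 ->
  cross_ratio ((a * r1 + b) / (c * r1 + d)) ((a * r2 + b) / (c * r2 + d))
    ((a * r3 + b) / (c * r3 + d)) ((a * r4 + b) / (c * r4 + d))
  = cross_ratio r1 r2 r3 r4.
Proof.
move=> D0 h1 h2 h3 h4.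
have dif r r' : c * r + d != 0 -> c * r' + d != 0 ->
  (a * r + b) / (c * r + d) - (a * r' + b) / (c * r' + d)
  = (a * d - b * c) / ((c * r + d) * (c * r' + d)) * (r - r').
  by move=> hr hr'; field; rewrite hr hr'.
rewrite /cross_ratio !dif //; set D := a * d - b * c in D0 *.
pose k := D ^+ 2 / ((c * r1 + d) * (c * r2 + d) * (c * r3 + d) * (c * r4 + d)).
have k0 : k != 0 by rewrite mulf_neq0 ?expf_neq0 // invr_neq0 // !mulf_neq0.
rewrite -[RHS]mul1r -(divff k0) mulf_div /k; congr (_ / _); field; by rewrite h1 h2 h3 h4.
Qed.

(** The Moebius map sends the roots of [f] to images under [s] of roots of [f], so the finite set
    [S] of cross-ratios is contained in [s(S)]. Comparing sizes gives equality, and [s] permutes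
    [S]. *)
Lemma moebius_roots_periodic n (s : {rmorphism L -> L}) (f : {poly L}) :
  (forall z, s z = z ^+ (p ^ n.+1)) -> f != 0 -> moebius_roots f (map_poly s f) ->
  forall r1 r2 r3 r4, root f r1 -> root f r2 -> root f r3 -> root f r4 ->
  periodic (cross_ratio r1 r2 r3 r4).
Proof.
move=> sE f0 [a [b [c [d [D0 Mf]]]]].
have [rs rsE] := closed_field_poly_normal f.
have rsP w : (w \in rs) = root f w.
  by rewrite rsE rootZ ?lead_coef_eq0 // root_prod_XsubC.
have [t sK tK] := frobenius_inverse sE.
have Mr r : root f r -> exists2 r', root f r' & (a * r + b) / (c * r + d) = s r'.
  move=> /rootP/Mf[_ fr]; exists (t ((a * r + b) / (c * r + d))); last by rewrite tK.
  by rewrite rootE -(fmorph_eq0 s) -horner_map /= tK fr.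
pose S := [seq cross_ratio u.1 u.2 v.1 v.2 |
   u <- [seq (x, y) | x <- rs, y <- rs], v <- [seq (x, y) | x <- rs, y <- rs]].
have SP w : reflect (exists r1 r2 r3 r4, [/\ root f r1, root f r2, root f r3 & root f r4] /\
     w = cross_ratio r1 r2 r3 r4) (w \in S).
  apply: (iffP allpairsP) => [[[u v] /= [/allpairsP[[r1 r2] /= [h1 h2 ->]]]]|].
    move=> /allpairsP[[r3 r4] /= [h3 h4 ->]] ->; exists r1, r2, r3, r4; split=> //=.
    by rewrite -!rsP.
  move=> [r1 [r2 [r3 [r4 [[h1 h2 h3 h4] ->]]]]].
  exists ((r1, r2), (r3, r4)); split=> //=; apply/allpairsP.
    by exists (r1, r2); rewrite /= !rsP.
  by exists (r3, r4); rewrite /= !rsP.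
have Ss w : w \in S -> w \in map s (undup S).
  move=> /SP[r1 [r2 [r3 [r4 [[h1 h2 h3 h4] ->]]]]].
  have [[[nz1 _] [nz2 _]] [[nz3 _] [nz4 _]]] :=
    ((Mf _ (rootP h1), Mf _ (rootP h2)), (Mf _ (rootP h3), Mf _ (rootP h4))).
  have [q1 g1 e1] := Mr _ h1; have [q2 g2 e2] := Mr _ h2.
  have [q3 g3 e3] := Mr _ h3; have [q4 g4 e4] := Mr _ h4.
  rewrite -(cross_ratio_moebius D0 nz1 nz2 nz3 nz4) e1 e2 e3 e4.
  apply/mapP; exists (cross_ratio q1 q2 q3 q4).
    by rewrite mem_undup; apply/SP; exists q1, q2, q3, q4.
  by rewrite /cross_ratio fmorph_div !rmorphM !rmorphB.
have sS w : w \in S -> w ^+ (p ^ n.+1) \in S.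
  have sub : {subset undup S <= map s (undup S)}.
    by move=> v; rewrite mem_undup; exact: Ss.
  have le : (size (map s (undup S)) <= size (undup S))%N by rewrite size_map.
  have [_ SE] := uniq_min_size (undup_uniq S) sub le.
  by move=> wS; rewrite -sE -mem_undup SE map_f // mem_undup.
move=> r1 r2 r3 r4 h1 h2 h3 h4; apply: (periodic_seq_stable sS).
by apply/SP; exists r1, r2, r3, r4.
Qed.

Lemma polyI_map (s : {rmorphism L -> L}) f : polyI (map_poly s f) = s (polyI f).
Proof. by rewrite /polyI /quarticI !coef_map /=; ring. Qed.

Lemma polyD_map (s : {rmorphism L -> L}) f : polyD (map_poly s f) = s (polyD f).
Proof. by rewrite /polyD /quarticD !coef_map /=; ring. Qed.

Theorem scroll_constant_model (f : {poly L}) e k (E' : seq {mpoly L[k.+1]}) :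
  (2%:R : L) != 0 -> (2 <= e)%N ->
  separable_poly f -> size f = e.*2.+1 ->
  (forall q, q \in E' -> forall m, periodic q@_m) ->
  proj_isomorphic (scroll_model e e.*2.+1 f) E' ->
  (e = 2%N /\ exists n, polyI f ^+ 3 * polyD f ^+ (p ^ n.+1)
      = (polyI f ^+ (p ^ n.+1)) ^+ 3 * polyD f) \/
  (forall r1 r2 r3 r4, root f r1 -> root f r2 -> root f r3 -> root f r4 ->
     periodic (cross_ratio r1 r2 r3 r4)).
Proof.
move=> two0 e2 sepf sf E'p iso.
have [n nE] : exists n, forall z, z \in flatten [seq [seq q@_m | m <- msupp q] | q <- E'] ->
    z ^+ (p ^ n.+1) = z.
  apply: periodic_seq => z /flatten_mapP[q qE /mapP[m _ ->]]; exact: E'p.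
have [s sE] := frobenius_power n.+1.
have [t sK tK] := frobenius_inverse sE.
have E'fix : base_change s E' = E'.
  apply: base_change_fixed => q qE m; rewrite sE.
  have [mq|mq] := boolP (m \in msupp q).
    by apply: nE; apply/flatten_mapP; exists q => //; exact: map_f.
  by rewrite memN_msupp_eq0 // expr0n expn_eq0 (gtn_eqF (prime_gt0 p_prime)).
(* [E'] is its own conjugate, so the conjugated isomorphism links the model of [map_poly s f] with
   the same [E']. *)
have := proj_isomorphic_conj sK tK iso; rewrite E'fix base_change_scroll.
move/proj_isomorphic_sym/(proj_isomorphic_trans iso) => iso'.
have sf' : size (map_poly s f) = e.*2.+1 by rewrite size_map_poly.
have sepf' : separable_poly (map_poly s f) by rewrite separable_map.
have f0 : f != 0 by rewrite -size_poly_gt0 sf.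
case: (scroll_isomorphic_dichotomy two0 e2 sepf sepf' sf sf' iso') => [[eE H]|H].
  by left; split=> //; exists n; rewrite -!sE -polyI_map -polyD_map.
by right; exact: (moebius_roots_periodic sE f0 H).
Qed.
End Periodic.

(** * Iterated quadratic polynomials *)

Section IteratedQuadratic.
Variable K : fieldType.
Implicit Types (gamma c z : K) (m : nat).

Lemma size_quad gamma c : size (quad gamma c) = 3%N.
Proof.
have s3 : size (('X - gamma%:P) ^+ 2) = 3%N by rewrite size_exp_XsubC.
by rewrite size_polyDl s3 // size_polyC; case: (_ != 0).
Qed.

Lemma size_iter_quad gamma c m : size (iter_poly (quad gamma c) m) = (2 ^ m).+1.
Proof.
elim: m => [|m IH]; first by rewrite size_polyX.
have := size_comp_poly (iter_poly (quad gamma c) m) (quad gamma c).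
rewrite IH size_quad -[_ \Po _]/(iter_poly (quad gamma c) m.+1) /= -expnSr.
by have := expn_gt0 2 m.+1; case: (size _) => [|k] /=; [case: (2 ^ _)%N|move=> _ ->].
Qed.

Lemma root_iter_quadS gamma c m z :
  root (iter_poly (quad gamma c) m.+1) z
  = root (iter_poly (quad gamma c) m) ((z - gamma) ^+ 2 + c).
Proof. by rewrite !rootE /iter_poly iterS horner_comp !horner_ringE. Qed.

Lemma map_iter_quad (L : fieldType) (iota : {rmorphism K -> L}) gamma c m :
  map_poly iota (iter_poly (quad gamma c) m) = iter_poly (quad (iota gamma) (iota c)) m.
Proof.
elim: m => [|m IH]; first by rewrite map_polyX.
rewrite /iter_poly !iterS map_comp_poly -/(iter_poly _ m) IH; congr (_ \Po _).
by rewrite rmorphD rmorphXn rmorphB /= map_polyX !map_polyC.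
Qed.
End IteratedQuadratic.

(** * Constancy of the parameters *)

Section Arithmetic.
Variables (L : closedFieldType) (p : nat) (g c : L).
Hypothesis charLp : p \in [pchar L].
Hypothesis two_neq0 : (2%:R : L) != 0.
Local Notation phi_iter m := (iter_poly (quad g c) m).
Local Notation periodic := (periodic p).
Implicit Types (a b d r s u v w : L) (m n : nat).

Let two_periodic : periodic 2%:R := periodic_nat charLp 2.

(** Inverts [w = (u - v) / (u + v)]. *)
Lemma periodic_ratio (u v w : L) : u != 0 -> w != -1 -> periodic w ->
  v * (1 + w) = u * (1 - w) -> periodic (v / u).
Proof.
move=> u0 w1 pw H; have w10 : 1 + w != 0 by rewrite addrC addr_eq0.
have -> : v / u = (1 - w) / (1 + w).
  by apply/eqP; rewrite eqr_div // H mulrC.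
have p1 := periodic_nat charLp 1.
apply: (periodicM charLp); first exact: (periodicB charLp).
by apply: (periodicV charLp); exact: (periodicD charLp).
Qed.

Lemma periodic_sqrt_ratio b b' : b != 0 ->
  periodic (cross_ratio (g + b) (g - b) (g + b') (g - b')) -> periodic (b' / b).
Proof.
(* For [b' = - b] the denominator of the cross-ratio vanishes. *)
move=> b0; have [E|E] := eqVneq (b + b') 0.
  move=> _; have -> : b' = - b by apply/eqP; rewrite -addr_eq0 addrC E.
  by rewrite mulNr divff //; apply: (periodicN charLp); exact: (periodic_nat charLp 1).
have -> : cross_ratio (g + b) (g - b) (g + b') (g - b') = ((b - b') / (b + b')) ^+ 2.
  rewrite /cross_ratio; field; rewrite E.
  by rewrite [X in X != 0](_ : _ = - (b + b')) ?oppr_eq0 ?E //; ring.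
move/(periodic_sqrt charLp) => pw; apply: (periodic_ratio b0 _ pw).
  rewrite -subr_eq0 opprK -[X in _ + X](divff E) -mulrDl.
  rewrite mulf_neq0 ?invr_neq0 // (_ : _ + _ = 2%:R * b) ?mulf_neq0 //; ring.
by field.
Qed.

Lemma periodic_shift_ratio d a : d != 0 -> periodic ((d + a) / (d - a)) -> periodic (a / d).
Proof.
move=> d0 pw; have [/eqP|E] := eqVneq (d - a) 0.
  by rewrite subr_eq0 => /eqP <-; rewrite divff //; exact: (periodic_nat charLp 1).
rewrite -[a]opprK mulNr; apply: (periodicN charLp).
apply: (periodic_ratio d0 _ pw); last by field.
rewrite -subr_eq0 opprK -[X in _ + X](divff E) -mulrDl.
by rewrite mulf_neq0 ?invr_neq0 // (_ : _ + _ = 2%:R * d) ?mulf_neq0 //; ring.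
Qed.

Lemma root_iter_preimage m r a : a ^+ 2 = r - c -> root (phi_iter m) r ->
  root (phi_iter m.+1) (g + a) /\ root (phi_iter m.+1) (g - a).
Proof.
move=> ar hr; have E : a ^+ 2 + c = r by rewrite ar subrK.
by rewrite !root_iter_quadS addrAC subrr add0r addrAC subrr add0r sqrrN E.
Qed.

(** With [d = g - c], the roots [g - a] and [g + a] have preimages [g + b] and [g + b'], where
    [b ^+ 2 = d - a] and [b' ^+ 2 = d + a]. Since [b' / b] is constant, so is
    [(d + a) / (d - a)]. *)
Lemma periodic_second_preimage n r a : g != c ->
  (forall r1 r2 r3 r4, root (phi_iter n.+2) r1 -> root (phi_iter n.+2) r2 ->
     root (phi_iter n.+2) r3 -> root (phi_iter n.+2) r4 ->
     periodic (cross_ratio r1 r2 r3 r4)) ->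
  root (phi_iter n) r -> a ^+ 2 = r - c -> periodic (a / (g - c)).
Proof.
move=> gc cr hr ar; have [h1 h2] := root_iter_preimage ar hr.
apply: periodic_shift_ratio; first by rewrite subr_eq0.
have [b bE] := closed_sqrt (g - a - c); have [b' b'E] := closed_sqrt (g + a - c).
have [k1 k2] := root_iter_preimage bE h2; have [k3 k4] := root_iter_preimage b'E h1.
have -> : g - c + a = b' ^+ 2 by rewrite b'E addrAC.
have -> : g - c - a = b ^+ 2 by rewrite bE addrAC.
(* Then [d = a], and the quotient by zero is [0]. *)
have [->|b0] := eqVneq b 0.
  by rewrite expr0n invr0 mulr0; exact: (periodic_nat charLp 0).
rewrite -expr_div_n expr2; have pb := periodic_sqrt_ratio b0 (cr _ _ _ _ k1 k2 k3 k4).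
exact: (periodicM charLp).
Qed.

(** Descent through the levels: [a = b ^+ 2 - (g - c)] whenever [b ^+ 2 = g + a - c]; at level zero
    the only root is [0], where [a ^+ 2 = - c]. *)
Lemma periodic_descent m : periodic (g - c) ->
  (forall r a, root (phi_iter m) r -> a ^+ 2 = r - c -> periodic a) -> periodic c.
Proof.
move=> pd; elim: m => [|m IH] H.
  have [a aE] := closed_sqrt (0 - c).
  have pa : periodic a by apply: H aE; rewrite rootE hornerX.
  have -> : c = - (a * a) by rewrite -expr2 aE sub0r opprK.
  by apply: (periodicN charLp); exact: (periodicM charLp).
apply: IH => r a hr ar; have [h1 _] := root_iter_preimage ar hr.
have [b bE] := closed_sqrt (g + a - c); have pb := H _ _ h1 bE.
have -> : a = b * b - (g - c) by rewrite -expr2 bE; ring.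
by apply: (periodicB charLp) => //; exact: (periodicM charLp).
Qed.

(** One level leads to the roots [g + a] and [g - a], and [periodic_second_preimage] takes two more
    above them; this makes [(d + a) / d^2] and [(d - a) / d^2] constant, and their sum is
    [2 / d]. *)
Lemma periodic_parameters m : (3 <= m)%N -> g != c ->
  (forall r1 r2 r3 r4, root (phi_iter m) r1 -> root (phi_iter m) r2 ->
     root (phi_iter m) r3 -> root (phi_iter m) r4 ->
     periodic (cross_ratio r1 r2 r3 r4)) ->
  periodic g /\ periodic c.
Proof.
case: m => [|[|[|k]]] // _ gc cr; set d := g - c.
have d0 : d != 0 by rewrite subr_eq0.
have half r a : root (phi_iter k) r -> a ^+ 2 = r - c ->
    periodic ((d + a) / d ^+ 2) /\ periodic ((d - a) / d ^+ 2).
  move=> hr ar; have [h1 h2] := root_iter_preimage ar hr.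
  have [b bE] := closed_sqrt (g + a - c); have [b' b'E] := closed_sqrt (g - a - c).
  have pb := periodic_second_preimage gc cr h1 bE.
  have pb' := periodic_second_preimage gc cr h2 b'E.
  have -> : d + a = b ^+ 2 by rewrite bE addrAC.
  have -> : d - a = b' ^+ 2 by rewrite b'E addrAC.
  by rewrite -!expr_div_n !expr2; split; exact: (periodicM charLp).
have [r hr] : exists r, root (phi_iter k) r.
  apply/closed_rootP; rewrite size_iter_quad eqSS expn_eq0.
  by [].
have [a ar] := closed_sqrt (r - c); have [p1 p2] := half r a hr ar.
have pd : periodic d.
  have -> : d = 2%:R / ((d + a) / d ^+ 2 + (d - a) / d ^+ 2).
    rewrite -mulrDl (_ : d + a + (d - a) = 2%:R * d); last by ring.
    by field; rewrite d0 two_neq0.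
  apply: (periodicM charLp) => //; apply: (periodicV charLp).
  exact: (periodicD charLp).
have pc : periodic c.
  apply: (periodic_descent (m := k) pd) => u b hu bu; have [q _] := half u b hu bu.
  have -> : b = (d + b) / d ^+ 2 * (d * d) - d by field.
  by apply: (periodicB charLp) => //; apply: (periodicM charLp) => //; exact: (periodicM charLp).
split=> //; have -> : g = d + c by rewrite subrK.
exact: (periodicD charLp).
Qed.

Lemma periodic_ratio_cross s : g != c -> s ^+ 2 = - c ->
  (forall r1 r2 r3 r4, root (phi_iter 2) r1 -> root (phi_iter 2) r2 ->
     root (phi_iter 2) r3 -> root (phi_iter 2) r4 ->
     periodic (cross_ratio r1 r2 r3 r4)) ->
  periodic ((g - c) / s).
Proof.
move=> gc sE cr; rewrite -invf_div; apply: (periodicV charLp).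
apply: (periodic_second_preimage gc cr (r := 0)); first by rewrite rootE hornerX.
by rewrite sub0r.
Qed.

(* The cross-ratio method fails on a curve of genus one, where an isomorphism
   need not respect [x]; there the [j]-invariant is computed instead. *)
Lemma iter_quad2_coefs : let d := c - g in
  phi_iter 2 = 'X^4 - (g *+ 4) *: 'X^3 + (g ^+ 2 *+ 4 + (g ^+ 2 + d) *+ 2) *: 'X^2
    - (g * (g ^+ 2 + d) *+ 4) *: 'X + ((g ^+ 2 + d) ^+ 2 + c)%:P.
Proof.
move=> d; rewrite /iter_poly /= comp_polyX /quad comp_polyD comp_polyC rmorphXn /=.
rewrite comp_polyB comp_polyX comp_polyC /d -!mul_polyC.
rewrite !(polyCD, polyCB, polyCMn, polyCM, polyCN, rmorphXn) /=.
ring.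
Qed.

Lemma polyI_iter_quad2 : polyI (phi_iter 2) = ((c - g) ^+ 2 *+ 4 + c *+ 3) *+ 4.
Proof.
rewrite iter_quad2_coefs /polyI /quarticI !(coefD, coefN, coefZ, coefXn, coefX, coefC) /=.
by ring.
Qed.

Lemma polyD_iter_quad2 : polyD (phi_iter 2) = c ^+ 2 * ((c - g) ^+ 2 + c) *+ 256.
Proof.
rewrite iter_quad2_coefs /polyD /quarticD !(coefD, coefN, coefZ, coefXn, coefX, coefC) /=.
by ring.
Qed.

(** Dividing by powers of [c] turns [I^3 / D] into a quarter of [j = (4 u + 3)^3 / (u + 1)], where
    [u = (c - g)^2 / c]. So a power of Frobenius fixes [j], and [u] is a root of the polynomial [P]
    with fixed coefficients. The square of [(g - c) / s] is [- u]. *)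
Lemma periodic_ratio_j s n : s ^+ 2 = - c -> c != 0 -> (c - g) ^+ 2 + c != 0 ->
  polyI (phi_iter 2) ^+ 3 * polyD (phi_iter 2) ^+ (p ^ n.+1)
    = (polyI (phi_iter 2) ^+ (p ^ n.+1)) ^+ 3 * polyD (phi_iter 2) ->
  periodic ((g - c) / s).
Proof.
move=> sE c0 D0; have [F FE] := frobenius_power charLp n.+1.
rewrite -!FE polyI_iter_quad2 polyD_iter_quad2; set d := c - g in D0 *.
pose u := d ^+ 2 / c => H.
have s0 : s != 0 by apply: contraNneq c0 => s0; rewrite -oppr_eq0 -sE s0 expr0n.
have four : (4%:R : L) != 0 by rewrite (natrM _ 2 2) mulf_neq0.
have u1 : u + 1 != 0.
  by rewrite /u -(divff c0) -mulrDl mulf_neq0 // invr_neq0.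
have Fu1 : F u + 1 != 0 by rewrite -(rmorph1 F) -rmorphD fmorph_eq0.
pose j := (u *+ 4 + 3%:R) ^+ 3 / (u + 1).
have Fj : F j = j.
  have dE : d ^+ 2 = u * c by rewrite divfK.
  have E : (u *+ 4 + 3%:R) ^+ 3 * (F u + 1) = (F u *+ 4 + 3%:R) ^+ 3 * (u + 1).
    have k0 : (4%:R : L) ^+ 7 * c ^+ 3 * F c ^+ 3 != 0.
      by rewrite !mulf_neq0 ?expf_neq0 ?fmorph_eq0.
    apply: (mulfI k0); move: H; rewrite dE => H.
    transitivity (((u * c *+ 4 + c *+ 3) *+ 4) ^+ 3 * F (c ^+ 2 * (u * c + c) *+ 256)); first by ring.
    by rewrite H; ring.
  rewrite /j fmorph_div !(rmorphXn, rmorphD, rmorphMn, rmorph1, rmorph_nat) /=.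
  by apply/eqP; rewrite eqr_div // -E mulrC.
pose P : {poly L} := ('X *+ 4 + 3%:R%:P) ^+ 3 - j *: ('X + 1%:P).
have pu : periodic u.
  apply: (@periodic_root _ _ charLp n P).
  (* At [-1] the value of [P] is [(-4 + 3)^3 = -1], nonzero in every characteristic. *)
  - apply: contraTneq isT => /(congr1 (horner^~ (-1))).
    rewrite /P !horner_ringE (_ : _ - _ = -1); last by ring.
    by move/eqP; rewrite oppr_eq0 oner_eq0.
  - move=> i; rewrite -FE -coef_map; congr (_`_i); rewrite /P.
    rewrite rmorphB rmorphXn rmorphD rmorphMn /= map_polyX map_polyZ Fj.
    rewrite [map_poly _ ('X + _)]rmorphD /= map_polyX !(map_polyC F) /=.
    by rewrite rmorph_nat rmorph1.
  rewrite rootE /P !horner_ringE /j subr_eq0; apply/eqP; by field.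
apply: (periodic_sqrt charLp); have -> : ((g - c) / s) ^+ 2 = - u.
  by rewrite expr_div_n sE /u -sqrrN opprB invrN mulrN.
exact: (periodicN charLp).
Qed.

End Arithmetic.

(** [gamma] is a critical point of the quadratic map, so by the chain rule the derivative of the
    next iterate vanishes there; separability then excludes a zero value at [gamma], and that value
    is the [m]-th iterate at [c]. *)
Lemma separable_critical_orbit (K : fieldType) (gamma c : K) m :
  separable_poly (iter_poly (quad gamma c) m.+1) ->
  (iter_poly (quad gamma c) m).[c] != 0.
Proof.
rewrite unlock => cop; apply/eqP => H0.
have phig : (quad gamma c).[gamma] = c.
  by rewrite !horner_ringE subrr mul0r add0r.
have dphi : (quad gamma c)^`() = ('X - gamma%:P) *+ 2.
  by rewrite derivD derivC addr0 deriv_exp derivXsubC mul1r.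
have fg : root (iter_poly (quad gamma c) m.+1) gamma.
  by rewrite rootE /iter_poly iterS horner_comp phig H0.
have := coprimep_root cop fg; rewrite /iter_poly iterS deriv_comp hornerM.
by rewrite dphi hornerMn hornerXsubC subrr mul0rn mulr0 eqxx.
Qed.

(** * Smoothness and isotriviality for equations over [K] *)

Section Hyperelliptic.
Variables (K : fieldType) (L : closedFieldType) (iota : {rmorphism K -> L}).
Variables (F : {poly K}) (e : nat).
Hypothesis two_neq0 : (2%:R : L) != 0.
Hypotheses (sepF : separable_poly F) (sF : size F = e.*2.+1).

Let halfF : (size F)./2 = e.
Proof. by rewrite sF /= uphalf_double. Qed.

Lemma hyperelliptic_smooth : (0 < e)%N -> smooth_curve iota (hyperelliptic F).
Proof.
move=> e0; rewrite /smooth_curve hyperellipticE base_change_scroll halfF sF.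
by apply: scroll_smooth; rewrite ?separable_map ?size_map_poly.
Qed.

Lemma hyperelliptic_isotrivial p : p \in [pchar L] -> (2 <= e)%N ->
  isotrivial iota p (hyperelliptic F) ->
  (e = 2%N /\ exists n, polyI (map_poly iota F) ^+ 3 * polyD (map_poly iota F) ^+ (p ^ n.+1)
      = (polyI (map_poly iota F) ^+ (p ^ n.+1)) ^+ 3 * polyD (map_poly iota F)) \/
  (forall r1 r2 r3 r4, root (map_poly iota F) r1 -> root (map_poly iota F) r2 ->
     root (map_poly iota F) r3 -> root (map_poly iota F) r4 ->
     periodic p (cross_ratio r1 r2 r3 r4)).
Proof.
move=> charLp e2 [k [E' [_ E'p]]]; rewrite hyperellipticE base_change_scroll halfF sF.
apply: scroll_constant_model; rewrite ?separable_map ?size_map_poly //.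
by move=> q qE m; apply/(in_FpbarP charLp); exact: E'p.
Qed.
End Hyperelliptic.

Theorem theorem2p4 (p : nat) (p_prime : prime p) (p_neq2 : p <> 2%N)
  (K : fieldExtType {fraction {poly 'F_p}})
  (L : closedFieldType) (iota : {rmorphism K -> L})
  (L_alg : forall z : L, algebraicOver iota z)
  (gamma c : K) (gamma_neq_c : gamma <> c)
  (nonconst : ~ (in_Fpbar p (iota gamma) /\ in_Fpbar p (iota c)))
  (s : L) (s_sqrt : s ^+ 2 = - iota c)
  (phi_sep : forall n : nat, (1 <= n)%N ->
     separable_poly (iter_poly (quad gamma c) n)) :
  let C (m : nat) := hyperelliptic (iter_poly (quad gamma c) m) in
  [/\ (forall t : L, in_Fpbar p t -> iota gamma <> iota c + t * s) ->
        smooth_curve iota (C 2%N) /\ ~ isotrivial iota p (C 2%N),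
      (exists t : L, [/\ in_Fpbar p t, t <> 0 & iota gamma = iota c + t * s]) ->
        smooth_curve iota (C 3%N) /\ ~ isotrivial iota p (C 3%N) &
      forall m : nat, (3 <= m)%N ->
        smooth_curve iota (C m) /\ ~ isotrivial iota p (C m)].
Proof.
have charLp : p \in [pchar L].
  apply: (rmorph_pchar iota); apply: (rmorph_pchar (in_alg K)).
  apply: (rmorph_pchar (@tofrac {poly 'F_p})); apply: (rmorph_pchar (@polyC 'F_p)).
  exact: pchar_Fp.
have two0 : (2%:R : L) != 0.
  rewrite -(dvdn_pcharf charLp); apply/negP => pd2; have p2 := dvdn_leq (isT : 0 < 2)%N pd2.
  by apply: p_neq2; apply/eqP; rewrite eqn_leq p2 prime_gt1.
have gc : iota gamma != iota c by rewrite (inj_eq (fmorph_inj iota)); apply/eqP.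
have sizeE m : size (iter_poly (quad gamma c) m.+1) = (2 ^ m).*2.+1.
  by rewrite size_iter_quad expnS mul2n.
(* For [m = 0] and [m = 1] these are the factors [c] and [(c - gamma)^2 + c] of the discriminant of
   the second iterate. *)
have critical m : (iter_poly (quad (iota gamma) (iota c)) m).[iota c] != 0.
  by apply: separable_critical_orbit; rewrite -map_iter_quad separable_map phi_sep.
move=> C.
have smoothC m : (1 <= m)%N -> smooth_curve iota (C m).
  case: m => // m m1; have e0 : (0 < 2 ^ m)%N by rewrite expn_gt0.
  exact: (hyperelliptic_smooth two0 (phi_sep m.+1 m1) (sizeE m) e0).
have C_ge3 m : (3 <= m)%N -> ~ isotrivial iota p (C m).
  case: m => // m m2 iso; have sepm := phi_sep m.+1 isT.
  (* The genus one alternative [e = 2] is excluded because [e = 2 ^ m] is at least [4]. *)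
  have e4 : (4 <= 2 ^ m)%N by rewrite -[4%N]/(2 ^ 2)%N leq_exp2l.
  case: (hyperelliptic_isotrivial two0 sepm (sizeE m) charLp (ltnW (ltnW e4)) iso).
    by case=> e2; rewrite e2 in e4.
  rewrite map_iter_quad => /(periodic_parameters charLp two0 m2 gc)[pg pc].
  by apply: nonconst; split; apply/(in_FpbarP charLp).
split=> [no_t|_|m m3]; last 2 first.
- by split; [exact: smoothC | exact: C_ge3].
- by split; [apply: smoothC; exact: ltnW (ltnW m3) | exact: C_ge3].
split; first exact: smoothC.
(* The witness for [t] is [(gamma - c) / s]; it is constant by the j-invariant in one alternative
   and by cross-ratios in the other. *)
move=> iso; have pt : periodic p ((iota gamma - iota c) / s).
  case: (hyperelliptic_isotrivial two0 (phi_sep 2%N isT) (sizeE 1%N) charLp isT iso);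
    rewrite map_iter_quad.
    case=> _ [n]; apply: (periodic_ratio_j charLp two0 s_sqrt).
      by have := critical 0%N; rewrite hornerX.
    by have := critical 1%N; rewrite /iter_poly /= comp_polyX !horner_ringE.
  exact: (periodic_ratio_cross charLp two0 gc s_sqrt).
apply: (no_t ((iota gamma - iota c) / s)); first exact/(in_FpbarP charLp).
(* [s] is nonzero because [c], the start of the critical orbit, is. *)
rewrite divfK ?subrKC //; apply/eqP => s0; have := critical 0%N.
by rewrite hornerX -oppr_eq0 -s_sqrt s0 expr0n eqxx.
Qed.
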